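(* For every $n\in\mathbb N$ the polynomial $\hat P_n^{(\nu)}(x)$ is symmetric, i.e. $\bigl(\hat P_n^{(\nu)}(x)\bigr)^t=\hat P_n^{(\nu)}(x)$. In particular, $\bigl(P_n^{(\nu)}(x)\bigr)^t=D_n^{(\nu)}\,P_n^{(\nu)}(x)\,(D_n^{(\nu)})^{-1}$.
   Context: $\mathbb N=\{0,1,2,\dots\}$; $\ell\in\frac12\mathbb N$ and real $\nu>0$ are fixed. $(a)_k=a(a+1)\cdots(a+k-1)$ is the Pochhammer symbol. The scalar Gegenbauer polynomials are $C_n^{(\nu)}(x)=\sum_{k=0}^{\lfloor n/2\rfloor}(-1)^k\frac{\Gamma(\nu+n-k)}{k!\,(n-2k)!\,\Gamma(\nu)}(2x)^{n-2k}$. All matrices have size $(2\ell+1)\times(2\ell+1)$, with rows and columns indexed by $0,1,\dots,2\ell$; $\mathbf 1$ is the identity matrix and ${}^t$ denotes the transpose. Matrix weight: for $x\in(-1,1)$, $W^{(\nu)}(x)$ is the (symmetric, positive definite) matrix with entries $$(W^{(\nu)}(x))_{i,j}=(1-x^2)^{\nu-\frac12}\sum_{k=\max(0,i+j-2\ell)}^{\min(i,j)}\alpha_k(i,j)\,C^{(\nu)}_{i+j-2k}(x),$$ $$\alpha_k(i,j)=(-1)^k\frac{i!\,j!\,(i+j-2k)!}{k!\,(2\nu)_{i+j-2k}(\nu)_{i+j-k}}\,\frac{(\nu)_{i-k}(\nu)_{j-k}}{(i-k)!\,(j-k)!}\,\frac{i+j-2k+\nu}{i+j-k+\nu}\,\frac{(2\ell-i)!\,(2\ell-j)!}{(2\ell+k-i-j)!}\,(-2\ell-\nu)_k\,\frac{2\ell+\nu}{(2\ell)!}.$$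 The monic matrix-valued Gegenbauer polynomials $P_n^{(\nu)}(x)=x^n\mathbf 1+(\text{lower order terms with matrix coefficients})$, $n\in\mathbb N$, are the unique monic matrix polynomials with $\int_{-1}^1P_n^{(\nu)}(x)W^{(\nu)}(x)P_m^{(\nu)}(x)^{*}\,dx=0$ for $n\neq m$. Put $\hat P_n^{(\nu)}(x)=D_n^{(\nu)}P_n^{(\nu)}(x)$, where $D_n^{(\nu)}$ is the diagonal matrix with $(D_n^{(\nu)})_{i,i}=\binom{2\ell}{i}\frac{(\nu+n)_i}{(\nu+n+2\ell-i)_i}$. *)

(* Defs.v *)
From HB Require Import structures.
From mathcomp Require Import all_boot all_order all_algebra.
From mathcomp Require Import complex.
From mathcomp Require Import all_classical all_reals all_analysis.

Set Implicit Arguments.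
Unset Strict Implicit.
Unset Printing Implicit Defensive.

Import Order.TTheory GRing.Theory Num.Theory.
Import numFieldNormedType.Exports.

Local Open Scope classical_set_scope.
Local Open Scope ring_scope.
Local Open Scope complex_scope.
Local Open Scope sesquilinear_scope.

(* Throughout, L : nat stands for 2ℓ with ℓ a half-integer, and the rows and
   columns of all matrices are indexed by 'I_L.+1, that is by 0, ..., 2ℓ. *)

Definition pochhammer (R : realType) (a : R) (k : nat) : R :=
  \prod_(j < k) (a + j%:R).

(* Euler's integral; only used for s > 0. *)
Definition Gamma (R : realType) (s : R) : R :=
  \int[@lebesgue_measure R]_(t in `]0, +oo[) (t `^ (s - 1) * expR (- t)).

Definition gegenbauer (R : realType) (nu : R) (n : nat) : {poly R} :=
  \sum_(0 <= k < (n./2).+1)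
    ((-1) ^+ k * (Gamma (nu + (n - k)%:R)
                   / (k`!%:R * (n - k.*2)`!%:R * Gamma nu)))
      *: (2 *: 'X) ^+ (n - k.*2).

(* The coefficients alpha_k(i, j). They are only used when
   i + j - L <= k <= minn i j and i, j <= L, and then none of the
   subtractions of natural numbers below is truncated. *)
Definition weight_coef (R : realType) (L : nat) (nu : R) (k i j : nat) : R :=
  (-1) ^+ k
  * ((i`!%:R * j`!%:R * (i + j - k.*2)`!%:R)
     / (k`!%:R * pochhammer (2 * nu) (i + j - k.*2)
               * pochhammer nu (i + j - k)))
  * ((pochhammer nu (i - k) * pochhammer nu (j - k))
     / ((i - k)`!%:R * (j - k)`!%:R))
  * (((i + j - k.*2)%:R + nu) / ((i + j - k)%:R + nu))
  * (((L - i)`!%:R * (L - j)`!%:R) / (L + k - (i + j))`!%:R)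
  * pochhammer (- L%:R - nu) k
  * ((L%:R + nu) / L`!%:R).

(* The truncated subtraction i + j - L is max(0, i + j - 2ℓ). *)
Definition weight (R : realType) (L : nat) (nu x : R) : 'M[R]_L.+1 :=
  \matrix_(i, j)
    ((1 - x ^+ 2) `^ (nu - 2^-1)
     * \sum_(i + j - L <= k < (minn i j).+1)
         weight_coef L nu k i j * (gegenbauer nu (i + j - k.*2)%N).[x]).

(* A matrix polynomial is evaluated at a scalar x by evaluating it, as a
   polynomial over the matrix ring, at the (central) scalar matrix x%:M. *)
Definition mxeval (R : realType) (L : nat) (p : {poly 'M[R[i]]_L.+1})
    (x : R[i]) : 'M[R[i]]_L.+1 := p.[x%:M].

(* Entrywise integral over (-1, 1) of a complex matrix-valued function. *)
Definition mxintegral (R : realType) (L : nat) (F : R -> 'M[R[i]]_L.+1) :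
    'M[R[i]]_L.+1 :=
  \matrix_(i, j)
    ((\int[@lebesgue_measure R]_(x in `]-1, 1[) complex.Re (F x i j))
     +i* (\int[@lebesgue_measure R]_(x in `]-1, 1[) complex.Im (F x i j))).

Definition mxinner (R : realType) (L : nat) (nu : R)
    (p q : {poly 'M[R[i]]_L.+1}) : 'M[R[i]]_L.+1 :=
  mxintegral (fun x : R =>
    mxeval p x%:C *m map_mx (real_complex R) (weight L nu x)
      *m (mxeval q x%:C) ^t*).

Definition monic_gegenbauer (R : realType) (L : nat) (nu : R)
    (P : nat -> {poly 'M[R[i]]_L.+1}) : Prop :=
  (forall n, P n \is monic /\ size (P n) = n.+1) /\
  (forall n m, n <> m -> mxinner nu (P n) (P m) = 0).

Definition Dmx (R : realType) (L : nat) (nu : R) (n : nat) : 'M[R[i]]_L.+1 :=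
  \matrix_(i, j)
    (('C(L, i)%:R * (pochhammer (nu + n%:R) i
                     / pochhammer (nu + n%:R + (L - i)%:R) i))%:C *+ (i == j)).

Definition hatP (R : realType) (L : nat) (nu : R)
    (P : nat -> {poly 'M[R[i]]_L.+1}) (n : nat) : {poly 'M[R[i]]_L.+1} :=
  (Dmx L nu n)%:P * P n.

(* Main.v *)
Require Import Defs.
From HB Require Import structures.
From mathcomp Require Import all_boot all_order all_algebra.
From mathcomp Require Import complex.
From mathcomp Require Import all_classical all_reals all_analysis.
From mathcomp Require Import measurable_realfun.
From mathcomp Require Import ring lra zify.

Set Implicit Arguments.
Unset Strict Implicit.
Unset Printing Implicit Defensive.

Import Order.TTheory GRing.Theory Num.Theory.
Import numFieldNormedType.Exports.

Local Open Scope classical_set_scope.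
Local Open Scope ring_scope.

(** Up to the factor (1 - x^2)^(nu - 1/2) the weight is a polynomial matrix W, and two-term
    identities for the coefficients alpha_k together with the Gegenbauer recurrences give
    relations moving its row index up and down.  In terms of the matrices H (diagonal), C and F
    of the (L + 1)-dimensional representation of sl2, they read
      (xH + F) W = (1 - x^2) Y   and   C W = (1 - x^2) (W' + Z) + L x W
    with Y and Z skew-symmetric, and Y and Z are primitives of commutators of W with H and H^2.
    Hence a first-order and a second-order differential operator acting from the right are
    symmetric for the matrix inner product, and P_n, so also D_n P_n, satisfies the two
    corresponding eigenvalue equations.  The derivative of a solution solves the same equations
    with n - 1 in place of n and nu + 1 in place of nu, so one can argue by induction on n: if
    the derivative is symmetric, then the antisymmetric part of the solution is constant, and the
    sl2 commutation relations yield two algebraic conditions on each of its entries that only 0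
    satisfies.  The entries of D_n matter only when the degree has come down to 1. *)

(** * Improper integrals over open intervals *)

(** Of the integral the algebra uses only linearity, one integration by parts and positivity on
    squares. No norms are computed; nondegeneracy of the matrix form comes from the leading
    coefficient of the weight. Both operators act from the right, while their eigenvalues are
    polynomials in the diagonal matrix H acting from the left; hence multiplication by [D_n]
    preserves the equations. Transposition gives operators acting from the left. These commute with
    the right ones up to terms in H, and on a constant antisymmetric part the defect is scalar in
    each entry (i, j). With p = L - 2i, q = L - 2j, tau = L + 2 nu and mu = tau + 2n, a nonzero
    entry is excluded by |p|, |q| <= L < tau and mu > tau + 2. Differentiation raises tau by 2 and
    fixes mu. In degree 1 one has mu = tau + 2, so the exclusion stops exactly there, and the
    remaining condition is a recurrence in i satisfied by the entries of [D_n]; they depend on nu +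
    n only, that is on mu, so one [D_n] serves the whole descent. The inner product is sesquilinear;
    pairing P_n with its conjugate family makes it bilinear. *)

Section improper.
Context {R : realType}.
Notation mu := (@lebesgue_measure R).
Implicit Types (g G h H : R -> R) (D : set R).

Lemma Rintegral_derive_cc g G (a b : R) : a < b ->
  (forall x, x \in `[a, b] -> {for x, continuous g}) ->
  (forall x, x \in `[a, b] -> is_derive x 1 G (g x)) ->
  (\int[mu]_(x in `[a, b]) (g x)%:E)%E = (G b - G a)%:E.
Proof.
move=> ab gc Gg.
have Gd x : x \in `[a, b] -> derivable G x 1 by move=> /Gg [].
have Gc : {within `[a, b], continuous G} by exact: derivable_within_continuous.
move/(continuous_within_itvP _ ab) : Gc => [_ Ga Gb].
rewrite EFinB; apply: continuous_FTC2 => //.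
- apply: continuous_in_subspaceT => x; rewrite inE; exact: gc.
- split=> // x xab; apply: Gd; exact: subset_itv_oo_cc xab.
- move=> x /subset_itv_oo_cc/Gg [_ <-]; by rewrite derive1E.
Qed.

(** The fundamental theorem of calculus is applied on the compact intervals, which stay away from
    the singular endpoints of [D]. *)
Definition exhausts D (u v : R^nat) :=
  [/\ open D, forall n, u n < v n, forall n, `[u n, v n] `<=` D,
      nondecreasing_seq (fun n => `[u n, v n]%classic)
    & forall x, D x -> \forall n \near \oo, x \in `[u n, v n]].

Lemma exhausts_bigcup D u v : exhausts D u v -> \bigcup_n `[u n, v n]%classic = D.
Proof.
move=> [_ _ sub _ ex]; apply/seteqP; split=> [x [n _]|x /ex]; first exact: sub.
by move=> [n _ /(_ n (leqnn n)) xn]; exists n.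
Qed.

Lemma exhausts_measurable D u v : exhausts D u v -> measurable D.
Proof. by case=> oD _ _ _ _; exact: open_measurable. Qed.

(** Monotone convergence: the integral over [[u n, v n]] is [G (v n) - G (u n)], hence at most
    [M + M]. *)
Lemma ge0_integrable_of_primitive D u v g G (M : R) : exhausts D u v ->
  (forall x, D x -> 0 <= g x) ->
  (forall x, D x -> {for x, continuous g}) ->
  (forall x, D x -> is_derive x 1 G (g x)) ->
  (forall x, D x -> `|G x| <= M) ->
  mu.-integrable D (EFin \o g).
Proof.
move=> exD g0 gc Gg GM; have [oD uv sub nd ex] := exD.
have mg : measurable_fun D g.
  by apply: open_continuous_measurable_fun => // x; rewrite inE; exact: gc.
apply/integrableP; split; first exact/measurable_EFinP.
apply: (@le_lt_trans _ _ (M + M)%:E); last by rewrite ltry.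
under eq_integral => x xD.
  rewrite /= ger0_norm; last by apply: g0; rewrite inE in xD.
  over.
rewrite -(exhausts_bigcup exD) /=.
have cv : (\int[mu]_(x in `[u n, v n]) (g x)%:E)%E @[n --> \oo] -->
    (\int[mu]_(x in \bigcup_n `[u n, v n]%classic) (g x)%:E)%E.
  apply: ge0_nondecreasing_set_cvg_integral => //.
  - move=> n; apply/measurable_EFinP; apply: measurable_funS (sub n) mg.
    exact: exhausts_measurable exD.
  - by move=> n x /sub /g0; rewrite lee_fin.
rewrite -(cvg_lim _ cv) //; apply: lime_le; first by apply/cvg_ex; eexists; exact: cv.
apply: nearW => n /=.
have -> : (\int[mu]_(x in `[u n, v n]) (g x)%:E = (G (v n) - G (u n))%:E)%E.
  by apply: Rintegral_derive_cc => // x /sub; [exact: gc|exact: Gg].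
rewrite lee_fin; apply: (le_trans (ler_norm _)); apply: (le_trans (ler_normB _ _)).
by apply: lerD; apply: GM; apply: (sub n); rewrite /= in_itv /= ?lexx ?(ltW (uv n)).
Qed.

(** Dominated convergence, with the absolute value of [g] as majorant of its restrictions to the
    compact intervals. *)
Lemma Rintegral_improper D u v g G (l : R) : exhausts D u v ->
  (forall x, D x -> {for x, continuous g}) ->
  (forall x, D x -> is_derive x 1 G (g x)) ->
  mu.-integrable D (EFin \o g) ->
  G (v n) - G (u n) @[n --> \oo] --> l ->
  \int[mu]_(x in D) g x = l.
Proof.
move=> exD gc Gg ig Gl; have [oD uv sub nd ex] := exD.
have mD := exhausts_measurable exD.
have mg : measurable_fun D g.
  by apply: open_continuous_measurable_fun => // x; rewrite inE; exact: gc.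
pose f n := (EFin \o g) \_ `[u n, v n]%classic.
have mf n : measurable_fun D (f n).
  apply/measurable_restrict => //.
  apply: measurable_funS mD _ _; first exact: subIsetl.
  exact/measurable_EFinP.
have fcv : {ae mu, forall x, D x -> f n x @[n --> \oo] --> (EFin \o g) x}.
  apply: aeW => x Dx; apply: cvg_near_cst; near=> n.
  by rewrite /f patchE mem_set //=; near: n; exact: ex.
have fle : {ae mu, forall x n, D x -> (`|f n x| <= (abse \o (EFin \o g)) x)%E}.
  apply: aeW => x n Dx; rewrite /f patchE; case: ifP => //= _.
  by rewrite normr0 lee_fin normr_ge0.
have mEg : measurable_fun D (EFin \o g) by exact/measurable_EFinP.
have [_ _ h] := @dominated_convergence _ (measurableTypeR R) R mu D mD f _ _
  mf mEg fcv (integrable_abse ig) fle.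
have fE n : (\int[mu]_(x in D) f n x = (G (v n) - G (u n))%:E)%E.
  transitivity (\int[mu]_(x in `[u n, v n]) (g x)%:E)%E; last first.
    by apply: Rintegral_derive_cc => // x /sub; [exact: gc|exact: Gg].
  rewrite /f -integral_mkcondr; congr (integral _ _ _).
  by apply/setIidPr; exact: sub.
rewrite /Rintegral; suff -> : (\int[mu]_(x in D) (g x)%:E = l%:E)%E by [].
have h2 : (G (v n) - G (u n))%:E @[n --> \oo] --> l%:E by apply: cvg_EFin => //; exact: nearW.
have h1 : (G (v n) - G (u n))%:E @[n --> \oo] --> (\int[mu]_(x in D) (g x)%:E)%E.
  apply: cvg_trans h.
  rewrite (_ : (fun n => (G (v n) - G (u n))%:E) = [sequence (\int[mu]_(x in D) f n x)%E]_n) //.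
  by apply/funext => n; rewrite /= fE.
by rewrite -(cvg_lim _ h1) // -(cvg_lim _ h2).
Unshelve. all: by end_near. Qed.

Lemma Rintegral_gt0 D g (x0 : R) : open D -> measurable D -> D x0 ->
  (forall x, D x -> 0 <= g x) ->
  mu.-integrable D (EFin \o g) ->
  {for x0, continuous g} -> 0 < g x0 ->
  0 < \int[mu]_(x in D) g x.
Proof.
move=> oD mD Dx0 g0 ig gc gx0.
have : \forall x \near x0, D x /\ g x0 / 2 <= g x.
  near=> x; split; first by near: x; exact: open_nbhs_nbhs.
  suff : `|g x0 - g x| < g x0 / 2.
    by rewrite ltr_norml => /andP[_]; lra.
  near: x; move/cvgrPdist_lt : gc; apply; lra.
move=> /nbhs_ballP[e /= e0 sub].
pose I := `[x0 - e / 2, x0 + e / 2]%classic.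
have mI : measurable I by exact: measurable_itv.
have subI : forall x, I x -> D x /\ g x0 / 2 <= g x.
  move=> x; rewrite /I /= in_itv /= => /andP[h1 h2]; apply: sub.
  by rewrite /ball /= ltr_norml; lra.
apply: (@lt_le_trans _ _ (\int[mu]_(x in I) (g x0 / 2))).
  rewrite Rintegral_cst; last exact: measurable_itv.
  have := lebesgue_measure_itv `[x0 - e / 2, x0 + e / 2].
  rewrite /= lte_fin ifT; last lra.
  move=> ->.
  rewrite -EFinB /=; apply: mulr_gt0; lra.
apply: (@le_trans _ _ (\int[mu]_(x in I) g x)).
  apply: le_Rintegral => //.
  - apply: continuous_compact_integrable; first exact: segment_compact.
    by apply: continuous_subspaceT => x; exact: cvg_cst.
  - by apply: integrableS ig => // x /subI[].
  - by move=> x /subI[].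
rewrite /Rintegral; apply: fine_le.
- apply: integrable_fin_num => //; by apply: integrableS ig => // x /subI[].
- exact: integrable_fin_num.
apply: ge0_subset_integral => //.
- by case/integrableP: ig.
- by move=> x /subI[].
Unshelve. all: by end_near. Qed.

Lemma integrable_lebesgueZl D g (c : R) : measurable D -> mu.-integrable D (EFin \o g) ->
  mu.-integrable D (EFin \o (fun x => c * g x)).
Proof. by move=> mD ig; exact: (@integrableZl _ (measurableTypeR R) R mu D mD c _ ig). Qed.

Lemma integrable_lebesgueB D g h : measurable D -> mu.-integrable D (EFin \o g) ->
  mu.-integrable D (EFin \o h) -> mu.-integrable D (EFin \o (fun x => g x - h x)).
Proof.
move=> mD ig ih; have := @integrableB _ (measurableTypeR R) R mu D mD _ _ ig ih.
by [].
Qed.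

Lemma le_integrable_lebesgue D g h : open D -> (forall x, D x -> {for x, continuous g}) ->
  (forall x, D x -> `|g x| <= h x) ->
  mu.-integrable D (EFin \o h) -> mu.-integrable D (EFin \o g).
Proof.
move=> oD gc gh; apply: le_integrable.
- exact: open_measurable.
- apply/measurable_EFinP; apply: open_continuous_measurable_fun => // x.
  by rewrite inE; exact: gc.
- by move=> x Dx; rewrite lee_fin; apply: (le_trans (gh x Dx)); exact: ler_norm.
Qed.
End improper.

(** * The Gamma function *)

Section gamma.
Context {R : realType}.
Notation mu := (@lebesgue_measure R).
Implicit Types (s t x : R).

(** The shift by two makes the interval nondegenerate already for [n = 0]. *)
Lemma exhausts_0y : exhausts (`]0, +oo[%classic : set R)
  (fun n => n.+2%:R^-1) (fun n => n.+2%:R).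
Proof.
have i1 n : (n.+2%:R^-1 : R) <= 1 by rewrite invf_le1 ?ler1n.
have v1 n : 1 < (n.+2%:R : R) by rewrite ltr1n.
split=> [||n x|n m nm|x].
- exact: interval_open.
- by move=> n; apply: le_lt_trans (i1 n) (v1 n).
- rewrite /= !in_itv /= andbT => /andP[+ _]; apply: lt_le_trans.
  by rewrite invr_gt0 ltr0n.
- apply/subsetPset => x; rewrite /= !in_itv /= => /andP[h1 h2].
  rewrite (le_trans _ h1) ?(le_trans h2) ?ler_nat ?ltnS //.
  by rewrite lef_pV2 ?posrE ?ltr0n // ler_nat.
- rewrite /= in_itv /= andbT => x0; near=> n; rewrite in_itv /=.
  have h : Num.max x x^-1 <= n%:R by near: n; exact: nbhs_infty_ger.
  move: h; rewrite ge_max => /andP[h1 h2].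
  have h3 : (n%:R : R) <= n.+2%:R by rewrite ler_nat; lia.
  apply/andP; split; last exact: le_trans h1 h3.
  rewrite -[leRHS]invrK lef_pV2 ?posrE ?invr_gt0 ?ltr0n //.
  exact: le_trans h2 h3.
Unshelve. all: by end_near. Qed.

(** From (1 + t)^k / k! <= exp (1 + t) with an integer k > |s|, which gives C = k! e. *)
Lemma exp_decay s : exists2 C : R, 0 <= C &
  forall t, 0 < t -> (1 + t) `^ s * expR (- t) <= C.
Proof.
pose k := (Num.trunc `|s|).+1.
exists (k`!%:R * expR 1); first by rewrite mulr_ge0 // expR_ge0.
move=> t t0; rewrite expRN ler_pdivrMr ?expR_gt0 // -mulrA -expRD.
apply: (@le_trans _ _ ((1 + t) `^ k%:R)).
  apply: ler_powR; first lra.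
  apply: (le_trans (ler_norm _)); apply: ltW; rewrite /k.
  exact: truncnS_gt.
rewrite powR_mulrn; last lra.
rewrite -ler_pdivrMl ?ltr0n ?fact_gt0 // mulrC.
have := @expR_ge1Dxn R (1 + t) k.-1; rewrite /k /= => h.
have /h : 0 <= 1 + t by lra.
by move=> {}h; apply: le_trans h; rewrite lerDr.
Qed.

(** For [s > 0] this primitive is bounded on the half-line. Its derivative behaves like t^(s-1) at 0
    and like t^(-2) at infinity, so one majorant controls the Gamma integrand at both ends. *)
Lemma is_derive_logistic_powR s t : s != 0 -> 0 < t ->
  is_derive t 1 (fun t => (t / (1 + t)) `^ s / s)
    ((t / (1 + t)) `^ (s - 1) / (1 + t) ^+ 2).
Proof.
move=> s0 t0.
have d1 : 1 + t != 0 by lra.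
have h : is_derive t 1 (fun t => t / (1 + t)) ((1 + t) ^- 2).
  apply: is_derive_eq; rewrite /= /GRing.scale /=; field; lra.
have p : 0 < t / (1 + t) by apply: divr_gt0; lra.
have hc : is_derive t 1 (fun t => (t / (1 + t)) `^ s) _ :=
  @is_derive1_comp R (fun x => x `^ s) (fun t => t / (1 + t)) t _ _ (is_derive1_powR s p) h.
have hz := @is_deriveZ _ _ _ _ s^-1 _ _ _ hc.
rewrite (_ : (fun _ => _) = s^-1 \*: (fun t => (t / (1 + t)) `^ s)); last first.
  by apply/funext => x /=; rewrite mulrC.
by apply: (is_derive_eq hz); rewrite /GRing.scale /=; field; rewrite d1.
Qed.

Lemma is_derive_powR_expRN s t : 0 < t ->
  is_derive t 1 (fun t => t `^ s * expR (- t))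
    (s * (t `^ (s - 1) * expR (- t)) - t `^ s * expR (- t)).
Proof.
move=> t0.
have h1 : is_derive t 1 (fun t => t `^ s) (s * t `^ (s - 1)) by exact: is_derive1_powR.
have h2 : is_derive t 1 (fun t => expR (- t)) (- expR (- t)).
  have hN : is_derive t 1 (fun t : R => - t) (-1) by apply: is_derive_eq.
  have := @is_derive1_comp R expR (fun t => - t) t _ _ (is_derive_expR _) hN.
  by rewrite mulrN1.
have := @is_deriveM _ _ _ _ _ _ _ _ h1 h2; rewrite /GRing.scale /= => h.
by apply: (is_derive_eq h); ring.
Qed.

Lemma is_derive_continuous (f : R -> R) x d : is_derive x 1 f d -> {for x, continuous f}.
Proof. by move=> [/derivable1_diffP/differentiable_continuous]. Qed.

Lemma cvg_invS2 : (n.+2%:R^-1 : R) @[n --> \oo] --> (0 : R).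
Proof.
have h := @cvg_harmonic R; rewrite -(cvg_shiftS (@harmonic R : nat -> R^o)) in h.
exact: h.
Qed.

Lemma powR_expRN_bound s : exists2 C : R, 0 <= C &
  forall t, 0 < t -> t `^ s * expR (- t) <= C / (1 + t) ^+ 2 * (t / (1 + t)) `^ s.
Proof.
(* The two extra powers of [1 + t] become the denominator of the bound. *)
have [C C0 CP] := exp_decay (s + 2).
exists C => // t t0.
have d : 0 < 1 + t by lra.
have -> : t `^ s = (t / (1 + t)) `^ s * (1 + t) `^ s.
  rewrite -powRM; [|by apply: divr_ge0; lra|lra].
  by rewrite divfK ?gt_eqF.
rewrite [leLHS]mulrAC -mulrA mulrC ler_wpM2r ?powR_ge0 //.
rewrite ler_pdivlMr ?exprn_gt0 // mulrC.
have := CP t t0; rewrite powRD; last by rewrite (gt_eqF d) implybT.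
by rewrite -(@powR_mulrn _ _ 2) ?(ltW d) //; congr (_ <= _); ring.
Qed.

Lemma Gamma_integrable s : 0 < s ->
  mu.-integrable (`]0, +oo[%classic : set R) (EFin \o (fun t => t `^ (s - 1) * expR (- t))).
Proof.
move=> s0; have [C C0 CP] := powR_expRN_bound (s - 1).
have ih : mu.-integrable (`]0, +oo[%classic : set R)
    (EFin \o (fun t => (t / (1 + t)) `^ (s - 1) / (1 + t) ^+ 2)).
  apply: (@ge0_integrable_of_primitive R _ _ _ _ (fun t => (t / (1 + t)) `^ s / s) s^-1 exhausts_0y).
  - move=> t; rewrite /= in_itv /= andbT => t0.
    by rewrite divr_ge0 ?powR_ge0 ?sqr_ge0.
  - move=> t; rewrite /= in_itv /= andbT => t0.
    have p : 0 < t / (1 + t) by apply: divr_gt0; lra.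
    have d1 : 1 + t != 0 by lra.
    have h1 : is_derive t 1 (fun t => t / (1 + t)) ((1 + t) ^- 2).
      by apply: is_derive_eq; rewrite /= /GRing.scale /=; field; lra.
    have h2 := @is_derive1_comp R (fun x => x `^ (s - 1)) (fun t => t / (1 + t)) t _ _
      (is_derive1_powR (s - 1) p) h1.
    have h3 : {for t, continuous (fun t => (1 + t) ^- 2)}.
      apply: cvgV; first by rewrite expf_neq0.
      apply: (@cvg_comp _ _ _ (fun t => 1 + t) (fun y => y ^+ 2)); last exact: exprn_continuous.
      by apply: cvgD; [exact: cvg_cst|exact: cvg_id].
    exact: cvgM (is_derive_continuous h2) h3.
  - move=> t; rewrite /= in_itv /= andbT => t0.
    by apply: is_derive_logistic_powR => //; rewrite gt_eqF.
  - move=> t; rewrite /= in_itv /= andbT => t0.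
    have p : 0 < t / (1 + t) by apply: divr_gt0; lra.
    rewrite ger0_norm ?divr_ge0 ?powR_ge0 ?(ltW s0) // ler_pdivrMr // mulVf ?gt_eqF //.
    apply: (@le_trans _ _ (1 `^ s)); last by rewrite powR1.
    apply: ge0_ler_powR; rewrite ?nnegrE ?(ltW s0) ?(ltW p) //.
    by rewrite ler_pdivrMr; lra.
have mD : measurable (`]0, +oo[%classic : set R) by exact: measurable_itv.
apply: (le_integrable_lebesgue _ _ _ (integrable_lebesgueZl C mD ih)).
- exact: interval_open.
- move=> t; rewrite /= in_itv /= andbT => t0.
  exact: (is_derive_continuous (is_derive_powR_expRN (s - 1) t0)).
- move=> t; rewrite /= in_itv /= andbT => t0.
  rewrite ger0_norm; first by have := CP t t0; congr (_ <= _); ring.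
  by rewrite mulr_ge0 ?powR_ge0 ?expR_ge0.
Qed.

Lemma Gamma_gt0 s : 0 < s -> 0 < Gamma s.
Proof.
move=> s0; apply: (@Rintegral_gt0 R _ _ 1).
- exact: interval_open.
- exact: measurable_itv.
- by rewrite /= in_itv /= ltr01.
- by move=> t _; rewrite mulr_ge0 ?powR_ge0 ?expR_ge0.
- exact: Gamma_integrable.
- exact: (is_derive_continuous (is_derive_powR_expRN (s - 1) ltr01)).
- by rewrite powR1 mul1r expR_gt0.
Qed.

Lemma GammaS s : 0 < s -> Gamma (s + 1) = s * Gamma s.
Proof.
move=> s0; apply/eqP; rewrite eq_sym -subr_eq0; apply/eqP.
have mD : measurable (`]0, +oo[%classic : set R) by exact: measurable_itv.
have i1 := Gamma_integrable s0.
have i2 : mu.-integrable (`]0, +oo[%classic : set R) (EFin \o (fun t => t `^ s * expR (- t))).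
  have := @Gamma_integrable (s + 1); rewrite addrK; apply; lra.
have i3 : mu.-integrable (`]0, +oo[%classic : set R)
    (EFin \o (fun t => s * (t `^ (s - 1) * expR (- t)))).
  exact: integrable_lebesgueZl.
rewrite /Gamma addrK -RintegralZl // -RintegralB //.
apply: (@Rintegral_improper R _ _ _ _ (fun t => t `^ s * expR (- t)) _ exhausts_0y).
- move=> t; rewrite /= in_itv /= andbT => t0.
  apply: (@is_derive_continuous _ _ _); apply: is_deriveB; last exact: is_derive_powR_expRN.
  apply: is_deriveZ; exact: is_derive_powR_expRN.
- by move=> t; rewrite /= in_itv /= andbT => t0; exact: is_derive_powR_expRN.
- exact: integrable_lebesgueB.
(* Boundary terms of the integration by parts: t^s exp(-t) is at most C / t at the upper end and at
   most t^s at the lower end. *)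
- rewrite -[0]subr0; apply: cvgB.
    have [C C0 CP] := exp_decay (s + 1).
    apply: (@squeeze_cvgr _ _ _ _ (fun=> 0) (fun n => C * n.+2%:R^-1)); last 2 first.
    + exact: cvg_cst.
    + by rewrite -[0](mulr0 C); apply: cvgMr; exact: cvg_invS2.
    apply: nearW => n; have t0 : 0 < (n.+2%:R : R) by rewrite ltr0n.
    rewrite mulr_ge0 ?powR_ge0 ?expR_ge0 //= ler_pdivlMr //.
    apply: le_trans (CP _ t0); rewrite mulrAC ler_wpM2r ?expR_ge0 //.
    rewrite -[X in _ * X](@powRr1 R); last exact: ltW.
    rewrite -powRD; last by rewrite (gt_eqF t0) implybT.
    by apply: ge0_ler_powR; rewrite ?nnegrE; lra.
  apply: (@squeeze_cvgr _ _ _ _ (fun=> 0) (fun n => n.+2%:R^-1 `^ s)); last 2 first.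
  + exact: cvg_cst.
  + have /cvg_at_rightP := powR_cvg0 s0; apply; split; last exact: cvg_invS2.
    by move=> n; rewrite invr_gt0 ltr0n.
  apply: nearW => n; have t0 : 0 < (n.+2%:R^-1 : R) by rewrite invr_gt0 ltr0n.
  rewrite mulr_ge0 ?powR_ge0 ?expR_ge0 //= ler_piMr ?powR_ge0 //.
Qed.

Lemma Gamma_pochhammer s k : 0 < s -> Gamma (s + k%:R) = pochhammer s k * Gamma s.
Proof.
move=> s0; rewrite /pochhammer; elim: k => [|k IH]; first by rewrite addr0 big_ord0 mul1r.
rewrite -natr1 addrA GammaS; last by rewrite ltr_wpDr.
by rewrite IH big_ord_recr /=; ring.
Qed.
End gamma.

(** * Integration of polynomials against the ultraspherical weight *)

Section ultraspherical_functional.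
Context {R : realType}.
Notation mu := (@lebesgue_measure R).
Notation D := (`]-1, 1[%classic : set R).
Implicit Types (s t x nu : R) (p q : {poly R}).

Lemma exhausts_m11 : exhausts D (fun n => n.+2%:R^-1 - 1) (fun n => 1 - n.+2%:R^-1).
Proof.
pose e n : R := n.+2%:R^-1.
have i0 n : 0 < e n by rewrite invr_gt0 ltr0n.
have i1 n : e n <= 2^-1 by rewrite lef_pV2 ?posrE ?ltr0n // ler_nat.
have i2 n m : (n <= m)%N -> e m <= e n.
  by move=> nm; rewrite lef_pV2 ?posrE ?ltr0n // ler_nat.
split=> [||n x|n m nm|x].
- exact: interval_open.
- by move=> n; have := i1 n; have := i0 n; rewrite /e; move: (_^-1) => a; lra.
- have := i0 n; have := i1 n; rewrite /= !in_itv /= /e; move: (n.+2%:R^-1) => a; lra.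
- apply/subsetPset => x; rewrite /= !in_itv /=; have := i2 _ _ nm; rewrite /e.
  move: (n.+2%:R^-1) (m.+2%:R^-1) => a b; lra.
- rewrite /= in_itv /= => /andP[x1 x2]; near=> n; rewrite in_itv /=.
  have h : (n.+2%:R^-1 : R) <= 1 - `|x|.
    near: n; apply: (cvgr_le _ cvg_invS2).
    by rewrite subr_gt0 ltr_norml x1.
  have := ler_norm x; have := ler_norm (- x); rewrite normrN.
  move: h; move: (n.+2%:R^-1) => a; lra.
Unshelve. all: by end_near. Qed.

Lemma horner_itv_bound p : exists2 M : R, 0 <= M & forall x, -1 < x < 1 -> `|p.[x]| <= M.
Proof.
exists (\sum_(i < size p) `|p`_i|); first by apply: sumr_ge0.
move=> x /andP[x1 x2]; rewrite horner_coef; apply: (le_trans (ler_norm_sum _ _ _)).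
apply: ler_sum => i _; rewrite normrM normrX ler_piMr //.
by rewrite exprn_ile1 // ler_norml !ltW.
Qed.

Lemma is_derive_horner p x : is_derive x 1 (fun x => p.[x]) (p^`()).[x].
Proof. by have := @is_derive_poly R p x. Qed.

Lemma is_derive_1px s x : -1 < x -> is_derive x 1 (fun x => (1 + x) `^ s) (s * (1 + x) `^ (s - 1)).
Proof.
move=> x1; have h1 : is_derive x 1 (fun x => 1 + x) 1.
  rewrite (_ : (fun _ => _) = (fun x => (1 + 'X).[x])); last by apply/funext => y; rewrite !hornerE.
  by apply: (is_derive_eq (is_derive_horner _ x)); rewrite !poly.derivE !hornerE.
have h : 0 < 1 + x by lra.
have := @is_derive1_comp R (fun y => y `^ s) (fun x => 1 + x) x _ _ (is_derive1_powR s h) h1.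
by rewrite mulr1.
Qed.

Lemma is_derive_1mx s x : x < 1 -> is_derive x 1 (fun x => (1 - x) `^ s) (- (s * (1 - x) `^ (s - 1))).
Proof.
move=> x1; have h1 : is_derive x 1 (fun x => 1 - x) (- 1).
  rewrite (_ : (fun _ => _) = (fun x => (1 - 'X).[x])); last by apply/funext => y; rewrite !hornerE.
  by apply: (is_derive_eq (is_derive_horner _ x)); rewrite !poly.derivE !hornerE.
have h : 0 < 1 - x by lra.
have := @is_derive1_comp R (fun y => y `^ s) (fun x => 1 - x) x _ _ (is_derive1_powR s h) h1.
by rewrite mulrN1.
Qed.

Lemma is_derive_1mx2 s x : -1 < x < 1 ->
  is_derive x 1 (fun x => (1 - x ^+ 2) `^ s) (- (2 * s * x * (1 - x ^+ 2) `^ (s - 1))).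
Proof.
move=> /andP[x1 x2]; have h1 : is_derive x 1 (fun x => 1 - x ^+ 2) (- (2 * x)).
  rewrite (_ : (fun _ => _) = (fun x => (1 - 'X^2).[x])); last by apply/funext => y; rewrite !hornerE.
  by apply: (is_derive_eq (is_derive_horner _ x)); rewrite !poly.derivE !hornerE /=; ring.
have h : 0 < 1 - x ^+ 2 by nra.
have := @is_derive1_comp R (fun y => y `^ s) (fun x => 1 - x ^+ 2) x _ _ (is_derive1_powR s h) h1.
by move=> h3; apply: (is_derive_eq h3); ring.
Qed.

Lemma continuous_weight nu p x : -1 < x < 1 ->
  {for x, continuous (fun x => (1 - x ^+ 2) `^ nu * p.[x])}.
Proof.
move=> x1.
exact: cvgM (is_derive_continuous (is_derive_1mx2 nu x1)) (is_derive_continuous (is_derive_horner p x)).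
Qed.

Lemma integrable_weight nu p : 0 < nu ->
  mu.-integrable D (EFin \o (fun x => (1 - x ^+ 2) `^ (nu - 2^-1) * p.[x])).
Proof.
move=> nu0; set m := nu - 2^-1; have mm : -1 < m by rewrite /m; lra.
have mD : measurable D by exact: measurable_itv.
have oD : open D by exact: interval_open.
have [M M0 MP] := horner_itv_bound p.
(* One of the factors 1 + x and 1 - x lies in [1, 2], where its power [m], of either sign, is at
   most [c]; the other factor is left to the majorant. *)
pose c : R := 2 `^ `|m|.
have ih : mu.-integrable D (EFin \o (fun x => (1 + x) `^ m + (1 - x) `^ m)).
  apply: (@ge0_integrable_of_primitive R _ _ _ _
    (fun x => (m + 1)^-1 * (1 + x) `^ (m + 1) - (m + 1)^-1 * (1 - x) `^ (m + 1))
    ((m + 1)^-1 * 2 `^ (m + 1) + (m + 1)^-1 * 2 `^ (m + 1)) exhausts_m11).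
  - by move=> x _; rewrite addr_ge0 ?powR_ge0.
  - move=> x; rewrite /= in_itv /= => /andP[x1 x2].
    by apply: cvgD; [exact: (is_derive_continuous (is_derive_1px m x1))
                    |exact: (is_derive_continuous (is_derive_1mx m x2))].
  - move=> x; rewrite /= in_itv /= => /andP[x1 x2].
    have h1 := @is_deriveZ _ _ _ _ (m + 1)^-1 _ _ _ (is_derive_1px (m + 1) x1).
    have h2 := @is_deriveZ _ _ _ _ (m + 1)^-1 _ _ _ (is_derive_1mx (m + 1) x2).
    have := is_deriveB h1 h2; rewrite /GRing.scale /= addrK => h.
    apply: (is_derive_eq h); field; lra.
  - move=> x; rewrite /= in_itv /= => /andP[x1 x2].
    have m0 : 0 <= (m + 1)^-1 by rewrite invr_ge0; lra.
    apply: (le_trans (ler_normB _ _)).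
    by apply: lerD; rewrite ger0_norm ?mulr_ge0 ?powR_ge0 // ler_wpM2l // ge0_ler_powR // ?nnegrE; lra.
apply: (le_integrable_lebesgue oD _ _ (integrable_lebesgueZl (c * M) mD ih)).
- by move=> x; rewrite /= in_itv /=; exact: continuous_weight.
- move=> x; rewrite /= in_itv /= => x1; rewrite normrM mulrAC.
  apply: ler_pM; rewrite ?normr_ge0 ?MP //.
  have x1' := x1; move/andP : x1 => [h1 h2].
  rewrite ger0_norm ?powR_ge0 // (_ : 1 - x ^+ 2 = (1 + x) * (1 - x)); last ring.
  rewrite powRM; [|lra..].
  have bd y : 1 <= y <= 2 -> y `^ m <= c.
    move=> /andP[y1 y2]; apply: (@le_trans _ _ (y `^ `|m|)).
      by apply: ler_powR => //; exact: ler_norm.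
    by apply: ge0_ler_powR; rewrite ?nnegrE ?normr_ge0 //; lra.
  have c0 : 0 <= c by exact: powR_ge0.
  have a0 := powR_ge0 (1 + x) m; have b0 := powR_ge0 (1 - x) m.
  have [x0|x0] := leP 0 x.
    have : (1 + x) `^ m <= c by apply: bd; lra.
    nra.
  have : (1 - x) `^ m <= c by apply: bd; lra.
  nra.
Qed.

Definition ultra_int nu p : R := \int[mu]_(x in D) ((1 - x ^+ 2) `^ (nu - 2^-1) * p.[x]).

Lemma ultra_intD nu p q : 0 < nu -> ultra_int nu (p + q) = ultra_int nu p + ultra_int nu q.
Proof.
move=> nu0; rewrite /ultra_int -RintegralD //; try exact: integrable_weight.
by apply: eq_Rintegral => x _; rewrite hornerD mulrDr.
Qed.

Lemma ultra_intZ nu c p : 0 < nu -> ultra_int nu (c *: p) = c * ultra_int nu p.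
Proof.
move=> nu0; rewrite /ultra_int -RintegralZl //; try exact: integrable_weight.
by apply: eq_Rintegral => x _; rewrite hornerZ mulrCA.
Qed.

(** The integrand is the derivative of (1 - x^2)^(nu + 1/2) p(x), which tends to 0 at both ends
    because nu + 1/2 > 0. *)
Lemma ultra_int_ibp nu p : 0 < nu ->
  ultra_int nu ((1 - 'X^2) * p^`() - (2 * nu + 1) *: ('X * p)) = 0.
Proof.
move=> nu0; have [M M0 MP] := horner_itv_bound p.
apply: (@Rintegral_improper R _ _ _ _ (fun x => (1 - x ^+ 2) `^ (nu + 2^-1) * p.[x]) _ exhausts_m11).
- by move=> x; rewrite /= in_itv /=; exact: continuous_weight.
- move=> x; rewrite /= in_itv /= => x1.
  have := @is_deriveM _ _ _ _ _ _ _ _ (is_derive_1mx2 (nu + 2^-1) x1) (is_derive_horner p x).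
  rewrite /GRing.scale /= => h; apply: (is_derive_eq h).
  rewrite !hornerE /= (_ : nu + 2^-1 - 1 = nu - 2^-1); last by field.
  have -> : (1 - x ^+ 2) `^ (nu + 2^-1) = (1 - x ^+ 2) `^ (nu - 2^-1) * (1 - x ^+ 2).
    have h0 : 0 < 1 - x ^+ 2 by move/andP : x1 => [? ?]; nra.
    rewrite -[X in _ * X](powRr1 (ltW h0)) -powRD; last by rewrite (gt_eqF h0) implybT.
    congr (_ `^ _); lra.
  by field.
- exact: integrable_weight.
- have [_ uv sub _ _] := exhausts_m11.
  have lim (x_ : R^nat) : (forall n, D (x_ n)) -> (forall n, 1 - x_ n ^+ 2 <= 2 * n.+2%:R^-1) ->
      (1 - x_ n ^+ 2) `^ (nu + 2^-1) * (p.[x_ n]) @[n --> \oo] --> (0 : R).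
    move=> Dx x_le.
    have h0 : (2 * n.+2%:R^-1) `^ (nu + 2^-1) @[n --> \oo] --> (0 : R).
      have /cvg_at_rightP : (a `^ (nu + 2^-1) @[a --> (0 : R)^'+] --> (0 : R)) by apply: powR_cvg0; lra.
      apply; split; first by move=> n; rewrite mulr_gt0 // invr_gt0 ltr0n.
      by rewrite -[X in _ --> X](mulr0 (2 : R)); apply: cvgMr; exact: cvg_invS2.
    have hM : (2 * n.+2%:R^-1) `^ (nu + 2^-1) * M @[n --> \oo] --> (0 : R).
      by rewrite -[X in _ --> X](mul0r M); apply: cvgMl.
    apply/norm_cvg0P; apply: (squeeze_cvgr _ (@cvg_cst _ (0 : R) _ _ _) hM).
    apply: nearW => n; rewrite normr_ge0 /=.
    have := Dx n; rewrite /= in_itv /= => x1.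
    rewrite normrM ler_pM ?MP // ger0_norm ?powR_ge0 //.
    move/andP : x1 => [? ?].
    by apply: ge0_ler_powR; rewrite ?nnegrE //; first lra; first nra; rewrite mulr_ge0 // invr_ge0 ler0n.
  rewrite -[X in _ --> X]subr0; apply: cvgB; apply: lim.
  + by move=> n; apply: (sub n); rewrite /= in_itv /= lexx ltW.
  + move=> n; have : 0 < (n.+2%:R^-1 : R) by rewrite invr_gt0 ltr0n.
    move: (n.+2%:R^-1) => a; nra.
  + by move=> n; apply: (sub n); rewrite /= in_itv /= lexx ltW.
  + move=> n; have : 0 < (n.+2%:R^-1 : R) by rewrite invr_gt0 ltr0n.
    move: (n.+2%:R^-1) => a; nra.
Qed.

Lemma poly_neq0_itv p : p != 0 -> exists2 x : R, -1 < x < 1 & p.[x] != 0.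
Proof.
move=> p0; apply: contrapT => h.
have rt x : -1 < x < 1 -> root p x.
  by move=> x1; apply/negPn/negP => px; apply: h; exists x.
(* These are [size p] distinct points of the interval, more than [p] can have roots. *)
pose s := [seq (i.+2%:R^-1 : R) | i <- iota 0 (size p)].
have : (size s < size p)%N.
  apply: max_poly_roots => //.
    apply/allP => _ /mapP[i _ ->]; apply: rt.
    have := i; rewrite invf_lt1 ?ltr0n // ltr1n /= andbT.
    by move=> _; apply: (@lt_trans _ _ 0) => //; rewrite invr_gt0 ltr0n.
  rewrite map_inj_uniq ?iota_uniq // => i j /invr_inj /eqP; rewrite eqr_nat => /eqP; lia.
by rewrite size_map size_iota ltnn.
Qed.

Lemma ultra_int_sq_gt0 nu p : 0 < nu -> p != 0 -> 0 < ultra_int nu (p * p).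
Proof.
move=> nu0 /poly_neq0_itv[x0 x01 px0].
apply: (@Rintegral_gt0 R D _ x0).
- exact: interval_open.
- exact: measurable_itv.
- by rewrite /= in_itv.
- by move=> x _; rewrite mulr_ge0 ?powR_ge0 // hornerM -expr2 sqr_ge0.
- exact: integrable_weight.
- exact: continuous_weight.
- rewrite mulr_gt0 //; last by rewrite hornerM -expr2 exprn_even_gt0.
  by apply: powR_gt0; move/andP : x01 => [? ?]; nra.
Qed.
End ultraspherical_functional.

(** * Gegenbauer polynomials *)

Section gegenbauer_recurrence.
Context {R : realType}.
Variables (nu : R) (nu_gt0 : 0 < nu).
Implicit Types (n k : nat).

Lemma pochhammerS (a : R) k : pochhammer a k.+1 = pochhammer a k * (a + k%:R).
Proof. by rewrite /pochhammer big_ord_recr. Qed.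

Lemma pochhammer0 (a : R) : pochhammer a 0 = 1.
Proof. by rewrite /pochhammer big_ord0. Qed.

Lemma pochhammer_gt0 (a : R) k : 0 < a -> 0 < pochhammer a k.
Proof. by move=> a0; apply: prodr_gt0 => i _; rewrite ltr_wpDr. Qed.

(** Extension by zero lets the sums for three consecutive degrees run over ranges of matching
    length. *)
Let term n k : {poly R} := if (k.*2 <= n)%N then
  ((-1) ^+ k * (pochhammer nu (n - k) / (k`!%:R * (n - k.*2)`!%:R))) *: (2 *: 'X) ^+ (n - k.*2)
  else 0.

Let gegenbauer_term n N : (n < N.*2)%N -> gegenbauer nu n = \sum_(k < N) term n k.
Proof.
move=> nN; rewrite /gegenbauer big_mkord.
have g0 := Gamma_gt0 nu_gt0.
transitivity (\sum_(k < n./2.+1) term n k).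
  apply: eq_bigr => -[k /= hk] _; rewrite /term ifT; last by lia.
  congr (_ *: _); congr (_ * _); rewrite Gamma_pochhammer //.
  have f1 : ((k`!%:R : R) != 0) by rewrite pnatr_eq0 -lt0n fact_gt0.
  have f2 : (((n - k.*2)`!%:R : R) != 0) by rewrite pnatr_eq0 -lt0n fact_gt0.
  by field; rewrite f1 f2 (gt_eqF g0).
have le_N : (n./2.+1 <= N)%N by lia.
rewrite (big_ord_widen N (term n) le_N).
rewrite big_mkcond; apply: eq_bigr => -[k /= hk] _; rewrite /term.
by case: ifP => //; case: ifP => //; lia.
Qed.

Let mulX_scale (c : R) e : 'X * (c *: (2 *: 'X) ^+ e) = (c / 2) *: (2 *: 'X) ^+ e.+1.
Proof.
rewrite exprS -(scalerAl 2 'X) scalerA divfK ?pnatr_eq0 //.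
by rewrite (scalerAr c 'X).
Qed.

Lemma gegenbauer0 : gegenbauer nu 0 = 1.
Proof.
rewrite (@gegenbauer_term 0 1) // big_ord1 /term /= subn0 pochhammer0 fact0 !expr0.
by rewrite mulr1 divr1 mulr1 scale1r.
Qed.

Lemma gegenbauer1 : gegenbauer nu 1 = (2 * nu) *: 'X.
Proof.
rewrite (@gegenbauer_term 1 1) // big_ord1 /term /= subn0 pochhammerS pochhammer0 expr1 scalerA.
by congr (_ *: _); rewrite factS !fact0; field.
Qed.

Lemma gegenbauerSS n : n.+2%:R *: gegenbauer nu n.+2 =
  (2 * (n.+1%:R + nu)) *: ('X * gegenbauer nu n.+1) - (n%:R + 2 * nu) *: gegenbauer nu n.
Proof.
rewrite (@gegenbauer_term n.+2 n.+2); last lia.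
rewrite (@gegenbauer_term n.+1 n.+2); last lia.
rewrite (@gegenbauer_term n n.+1); last lia.
(* With the terms of index 0 split off, index [k.+1] in degrees [n.+2] and [n.+1] and index [k] in
   degree [n] all belong to the power [n - k.*2] of X. *)
rewrite mulr_sumr !scaler_sumr big_ord_recl [X in _ = X - _]big_ord_recl -addrA.
congr (_ + _); last first.
  rewrite -sumrB; apply: eq_bigr => k _.
  rewrite /term /= /bump /= add1n doubleS !subSS !ltnS.
  have [h1|h1] := leqP k.*2 n; last by rewrite ifF ?scaler0 ?mulr0 ?scaler0 ?subr0 //; lia.
  have f1 : ((k`!%:R : R) != 0) by rewrite pnatr_eq0 -lt0n fact_gt0.
  have k1 : (k%:R + 1 : R) != 0 by rewrite natr1 pnatr_eq0.
  rewrite factS; set d := (n - k.*2)%N.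
  have -> : (n.+1 - k = (n - k).+1)%N by lia.
  have -> : (n - k = k + d)%N by lia.
  have -> : n%:R = 2 * k%:R + d%:R :> R by rewrite /d natrB // -muln2 natrM; ring.
  (* For [n = k.*2] this power is 0, and degree [n.+1] contributes no term. *)
  case: ifP => h2; last first.
    have -> : d = 0%N by rewrite /d; lia.
    rewrite mulr0 scaler0 sub0r !scalerA -scaleNr; congr (_ *: _).
    have n2 : n%:R = 2 * k%:R :> R by rewrite -natrM; congr _%:R; lia.
    rewrite -[n.+2%:R]natr1 -[n.+1%:R]natr1 n2 addn0 pochhammerS fact0 natrM -natr1 exprS.
    field; rewrite ?f1 ?k1 //=.
  have [e de] : exists e, d = e.+1 by exists (n - k.*2).-1; rewrite /d; lia.
  have -> : (n - k.*2.+1 = e)%N by move: de; rewrite /d; lia.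
  rewrite de mulX_scale.
  rewrite !scalerA -scalerBl; congr (_ *: _).
  have f2 : ((e`!%:R : R) != 0) by rewrite pnatr_eq0 -lt0n fact_gt0.
  have e1 : (e%:R + 1 : R) != 0 by rewrite natr1 pnatr_eq0.
  have n2 : n%:R = 2 * k%:R + e%:R + 1 :> R.
    by rewrite -natrM -natrD natr1; congr _%:R; move: de; rewrite /d; lia.
  rewrite -[n.+2%:R]natr1 -[n.+1%:R]natr1 n2 pochhammerS !factS !natrM -!natr1 !natrD -natr1 exprS.
  field; rewrite ?f1 ?k1 ?f2 ?e1 //=.
rewrite /term /= !subn0 mulX_scale !scalerA fact0 expr0.
have f2 : ((n`!%:R : R) != 0) by rewrite pnatr_eq0 -lt0n fact_gt0.
congr (_ *: _).
rewrite [pochhammer _ n.+2]pochhammerS !factS !natrM -!natr1.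
field; rewrite f2 !natr1 !pnatr_eq0 //=.
Qed.

Let v : {poly R} := nu%:P.
Let C n := gegenbauer nu n.

(** The value 0 in degree -1 makes the recurrences below valid at [n = 0]. *)
Definition gegenbauer_pred n : {poly R} := if n is n'.+1 then gegenbauer nu n' else 0.
Let Cp := gegenbauer_pred.

Lemma gegenbauer_rec n :
  n.+1%:R * C n.+1 = 2 * (n%:R + v) * 'X * C n - (n%:R + 2 * v - 1) * Cp n.
Proof.
rewrite /C /Cp /v; case: n => [|n] /=.
  by rewrite gegenbauer0 gegenbauer1 -mul_polyC polyCM -(polyC_natr _ 2); ring.
have := gegenbauerSS n.
rewrite -!mul_polyC !polyCM !polyCD !polyCM !polyC_natr => ->.
by rewrite -!natr1; ring.
Qed.

Lemma deriv_gegenbauer_rec n : n.+2%:R * (C n.+2)^`() =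
  2 * (n.+1%:R + v) * (C n.+1 + 'X * (C n.+1)^`()) - (n%:R + 2 * v) * (C n)^`().
Proof.
have /(congr1 (@deriv R)) := gegenbauerSS n.
rewrite derivB !derivZ derivM derivX mul1r.
rewrite -!mul_polyC !polyCM !polyCD !polyCM !polyC_natr => ->.
by rewrite /v /C; ring.
Qed.

(** The differentiated three-term recurrence expresses the derivative in degree [n.+2] by those in
    the two preceding degrees, so the induction carries a pair of degrees. *)
Lemma deriv_gegenbauer_pred n :
  (1 - 'X^2) * (C n)^`() = - n%:R * 'X * C n + (n%:R + 2 * v - 1) * Cp n.
Proof.
suff : (1 - 'X^2) * (C n)^`() = - n%:R * 'X * C n + (n%:R + 2 * v - 1) * Cp n /\
  (1 - 'X^2) * (C n.+1)^`() = - n.+1%:R * 'X * C n.+1 + (n.+1%:R + 2 * v - 1) * Cp n.+1 by case.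
elim: n => [|n [IH1 IH2]].
  rewrite /C /Cp /v /= gegenbauer0 gegenbauer1 derivC derivZ derivX -!mul_polyC polyCM -(polyC_natr _ 2).
  by split; ring.
split=> //; have n0 : n.+2%:R != 0 :> {poly R} by rewrite -polyC_natr polyC_eq0 pnatr_eq0.
apply: (mulfI n0); rewrite mulrCA deriv_gegenbauer_rec.
transitivity (2 * (n.+1%:R + v) * ((1 - 'X^2) * C n.+1 + 'X * ((1 - 'X^2) * (C n.+1)^`()))
   - (n%:R + 2 * v) * ((1 - 'X^2) * (C n)^`())); first by ring.
have G : (n%:R + 2 * v - 1) * Cp n = 2 * (n%:R + v) * 'X * C n - n.+1%:R * C n.+1.
  by rewrite gegenbauer_rec; ring.
rewrite IH1 IH2 G.
transitivity (- n.+2%:R * 'X * (n.+2%:R * C n.+2)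
  + n.+2%:R * (n.+2%:R + 2 * v - 1) * C n.+1); last first.
  by rewrite /Cp /= -/(C n.+1); ring.
rewrite (gegenbauer_rec n.+1) /Cp /= -/(C n).
by rewrite -!natr1; ring.
Qed.

Lemma deriv_gegenbauer n :
  (1 - 'X^2) * (C n)^`() = (n%:R + 2 * v) * 'X * C n - n.+1%:R * C n.+1.
Proof. by rewrite deriv_gegenbauer_pred gegenbauer_rec; ring. Qed.

Lemma gegenbauer_ode n : (1 - 'X^2) * (C n)^`()^`() - (2 * v + 1) * 'X * (C n)^`()
  = - (n%:R * (n%:R + 2 * v)) * C n.
Proof.
have x0 : 1 - 'X^2 != 0 :> {poly R}.
  by rewrite -opprB oppr_eq0 (monic_neq0 (monicXnsubC _ _)).
case: n => [|n].
  by rewrite /C gegenbauer0 derivC linear0; ring.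
apply: (mulfI x0).
have /(congr1 (@deriv R)) := deriv_gegenbauer_pred n.+1.
rewrite derivM.
have -> : (1 - 'X^2 : {poly R})^`() = - (2 * 'X) by rewrite !poly.derivE; ring.
have -> : (- n.+1%:R * 'X * C n.+1 + (n.+1%:R + 2 * v - 1) * Cp n.+1)^`() =
    - n.+1%:R * (C n.+1 + 'X * (C n.+1)^`()) + (n.+1%:R + 2 * v - 1) * (C n)^`().
  rewrite (_ : _ + _ = (- n.+1%:R) *: ('X * C n.+1) + (n.+1%:R + 2 * nu - 1) *: C n); last first.
    by rewrite -!mul_polyC !polyCD !polyCN !polyCM !polyC_natr /v /C /Cp /=; ring.
  rewrite derivD !derivZ derivM derivX.
  by rewrite -!mul_polyC !polyCD !polyCN !polyCM !polyC_natr /v; ring.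
move=> h.
have {}h : (1 - 'X^2) * (C n.+1)^`()^`() = 2 * 'X * (C n.+1)^`()
   - n.+1%:R * (C n.+1 + 'X * (C n.+1)^`()) + (n.+1%:R + 2 * v - 1) * (C n)^`().
  transitivity ((- (2 * 'X) * (C n.+1)^`() + (1 - 'X^2) * (C n.+1)^`()^`())
    + 2 * 'X * (C n.+1)^`()); first by ring.
  by rewrite h; ring.
rewrite h.
transitivity (2 * 'X * ((1 - 'X^2) * (C n.+1)^`())
   - n.+1%:R * ((1 - 'X^2) * C n.+1 + 'X * ((1 - 'X^2) * (C n.+1)^`()))
   + (n.+1%:R + 2 * v - 1) * ((1 - 'X^2) * (C n)^`())
   - (2 * v + 1) * 'X * ((1 - 'X^2) * (C n.+1)^`())); first by ring.
by rewrite (deriv_gegenbauer n) deriv_gegenbauer_pred /= -!natr1 -/(C n); ring.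
Qed.

Lemma size_gegenbauer n : size (C n) = n.+1.
Proof.
suff : size (C n) = n.+1 /\ size (C n.+1) = n.+2 by case.
elim: n => [|n [IH1 IH2]].
  rewrite /C gegenbauer0 gegenbauer1 size_poly1 size_scale ?size_polyX //.
  by rewrite mulf_neq0 ?pnatr_eq0 // gt_eqF.
split=> //; have := gegenbauerSS n; rewrite -/(C _) -/(C _) -/(C _).
move=> /(congr1 (fun p : {poly R} => size p)).
rewrite size_scale ?pnatr_eq0 // => ->.
have CX : size ((2 * (n.+1%:R + nu)) *: ('X * C n.+1)) = n.+3.
  rewrite size_scale ?mulf_neq0 ?pnatr_eq0 ?gt_eqF ?ltr_wpDl //.
  by rewrite mulrC size_mulX ?IH2 // -size_poly_eq0 IH2.
rewrite size_polyDl CX // size_polyN; apply: leq_ltn_trans (size_scale_leq _ _) _.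
by rewrite IH1.
Qed.
End gegenbauer_recurrence.

(** * Ladder relations of the weight *)

Section weight_ladder.
Context {R : realType}.
Variables (nu : R) (nu_gt0 : 0 < nu).
Implicit Types (L n k i j a b c : nat).

(* [weight_coef] at i = k + a, j = k + b, L = k + a + b + c: these parameters range freely
   over nat, and no truncated subtraction remains. *)
Definition wc k a b c : R :=
  (-1) ^+ k * (((k + a)`!%:R * (k + b)`!%:R * (a + b)`!%:R)
     / (k`!%:R * pochhammer (2 * nu) (a + b) * pochhammer nu (k + a + b)))
  * ((pochhammer nu a * pochhammer nu b) / (a`!%:R * b`!%:R))
  * (((a + b)%:R + nu) / ((k + a + b)%:R + nu))
  * (((b + c)`!%:R * (a + c)`!%:R) / c`!%:R)
  * pochhammer (- (k + a + b + c)%:R - nu) k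
  * (((k + a + b + c)%:R + nu) / (k + a + b + c)`!%:R).

Lemma wcE k a b c : weight_coef (k + a + b + c) nu k (k + a) (k + b) = wc k a b c.
Proof.
rewrite /weight_coef /wc.
have -> : (k + a + (k + b) - k.*2 = a + b)%N by lia.
have -> : (k + a + (k + b) - k = k + a + b)%N by lia.
have -> : (k + a - k = a)%N by lia.
have -> : (k + b - k = b)%N by lia.
have -> : (k + a + b + c - (k + a) = b + c)%N by lia.
have -> : (k + a + b + c - (k + b) = a + c)%N by lia.
by have -> : (k + a + b + c + k - (k + a + (k + b)) = c)%N by lia.
Qed.

Let f_neq0 n : (n`!%:R : R) != 0.
Proof. by rewrite pnatr_eq0 -lt0n fact_gt0. Qed.

Let p_neq0 n : pochhammer nu n != 0.
Proof. by rewrite gt_eqF // pochhammer_gt0. Qed.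

Let p2_neq0 n : pochhammer (2 * nu) n != 0.
Proof. by rewrite gt_eqF // pochhammer_gt0 // mulr_gt0. Qed.

Ltac wc_expand :=
  rewrite /wc ?(addnS, addSn, addn0, add0n, factS, pochhammerS, exprS, natrM, fact0, pochhammer0).
Ltac gen_atoms := repeat match goal with
  | |- context [factorial ?n] => let x := fresh "f" in let h := fresh "hf" in
     have h := f_neq0 n; move: ((factorial n)%:R : R) h => x h
  | |- context [pochhammer (2 * nu) ?n] => let x := fresh "p" in let h := fresh "hp" in
     have h := p2_neq0 n; move: (pochhammer (2 * nu) n) h => x h
  | |- context [pochhammer nu ?n] => let x := fresh "p" in let h := fresh "hp" in
     have h := p_neq0 n; move: (pochhammer nu n) h => x h
  | |- context [pochhammer ?x ?n] => let p := fresh "p" in move: (pochhammer x n) => p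
  | |- context [(-1) ^+ ?n] => let p := fresh "s" in move: ((-1) ^+ n : R) => p
  end.
Ltac gen_nats := repeat match goal with
  | n : nat |- _ => let x := fresh "x" in let h := fresh "hx" in
    have h := ler0n R n; move: (n%:R : R) h => x h; clear n end.
Ltac ge0 := first [assumption | exact: ler01 | exact: ler0n
  | apply: addr_ge0; ge0 | apply: mulr_ge0; ge0].
Ltac gt0 := first [assumption | exact: ltr01 | exact: ltr0Sn | apply: mulr_gt0; gt0
  | apply: ltr_wpDr; [solve [ge0] | solve [gt0]] | apply: ltr_wpDl; [solve [ge0] | solve [gt0]]].
Ltac nonzero := have nu0 := nu_gt0; have nu0' := ltW nu_gt0;
  repeat (apply/andP; split); rewrite ?oppr_eq0 //; apply: lt0r_neq0; gt0.

Ltac wc_field := wc_expand; gen_atoms; rewrite -?natr1 ?natrD; gen_nats; field; nonzero.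
Ltac ratio_field :=
  match goal with |- context [wc ?k ?a ?b ?c] =>
    let w := fresh "w" in move: (wc k a b c) => w end;
  rewrite ?(addnS, addSn, addn0, add0n) -?natr1 ?natrD; gen_nats; field; nonzero.

(** In the original indices this ratio and the next fix [j] and [L] and move [i] by one, with [k]
    either fixed or moved along with [i]. Both are closed products, so the two-term identities
    reduce to identities of rational functions. *)
Lemma wc_ratio_a k a b c : wc k a b c.+1 = wc k a.+1 b c *
  (((a + b)%:R + 2 * nu) * a.+1%:R * ((a + b)%:R + nu) * ((k + a + b).+1%:R + nu) * (b + c).+1%:R
   / ((k + a).+1%:R * (a + b).+1%:R * (a%:R + nu) * ((a + b).+1%:R + nu) * c.+1%:R)).
Proof. wc_field. Qed.

Lemma wc_ratio_k k a b c : wc k.+1 a b c = wc k a b.+1 c *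
  ((k + a).+1%:R * ((a + b)%:R + 2 * nu) * b.+1%:R * ((a + b)%:R + nu) * ((a + b + c).+1%:R + nu)
   / ((a + b).+1%:R * k.+1%:R * (b%:R + nu) * ((a + b).+1%:R + nu) * (b + c).+1%:R)).
Proof. wc_field. Qed.

Lemma wc_down k a b c :
  2 * (k + a).+1%:R * wc k a b.+1 c.+1 =
  wc k a.+1 b.+1 c * ((a + b.+2)%:R + 2 * nu - 1) * 2 * a.+1%:R * ((k + a + b.+2)%:R + nu)
     / (((a + b.+2)%:R + nu) * (a + b.+2)%:R)
  + wc k.+1 a b c.+1 * (a + b.+1)%:R * 2 * k.+1%:R * (b%:R + nu)
     / (((a + b)%:R + nu) * ((a + b)%:R + 2 * nu)).
Proof. rewrite wc_ratio_k wc_ratio_a; ratio_field. Qed.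

(** At the border of the summation range one of the two terms of [wc_down] drops out: the one with
    [k.+1] here, the one with [k] in [wc_down_c0]. *)
Lemma wc_down_b0 k a c :
  2 * (k + a).+1%:R * wc k a 0 c.+1 =
  wc k a.+1 0 c * (a.+1%:R + 2 * nu - 1) * 2 * a.+1%:R * ((k + a.+1)%:R + nu)
     / ((a.+1%:R + nu) * a.+1%:R).
Proof. rewrite wc_ratio_a; ratio_field. Qed.

Lemma wc_down_c0 k a b :
  2 * (k + a).+1%:R * wc k a b.+1 0 =
  wc k.+1 a b 0 * (a + b.+1)%:R * 2 * k.+1%:R * (b%:R + nu)
     / (((a + b)%:R + nu) * ((a + b)%:R + 2 * nu)).
Proof. rewrite wc_ratio_k; ratio_field. Qed.

Lemma wc_up k a b c :
  2 * (b + c).+1%:R * wc k.+1 a.+1 b c =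
  wc k.+1 a b c.+1 * (a + b).+1%:R * 2 * c.+1%:R * (a%:R + nu)
     / (((a + b)%:R + nu) * ((a + b)%:R + 2 * nu))
  + wc k a.+1 b.+1 c * ((a + b).+2%:R + 2 * nu - 1) * 2 * b.+1%:R * ((a.+1 + b.+1 + c)%:R + nu)
     / (((a + b).+2%:R + nu) * (a + b).+2%:R).
Proof. rewrite wc_ratio_a wc_ratio_k; ratio_field. Qed.

Lemma wc_up_k0 a b c :
  2 * (b + c).+1%:R * wc 0 a.+1 b c =
  wc 0 a b c.+1 * (a + b).+1%:R * 2 * c.+1%:R * (a%:R + nu)
     / (((a + b)%:R + nu) * ((a + b)%:R + 2 * nu)).
Proof. rewrite wc_ratio_a; ratio_field. Qed.

Lemma wc_up_a0 k b c :
  2 * (b + c).+1%:R * wc k.+1 0 b c =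
  wc k 0 b.+1 c * (b.+1%:R + 2 * nu - 1) * 2 * b.+1%:R * ((b.+1 + c)%:R + nu)
     / ((b.+1%:R + nu) * b.+1%:R).
Proof. rewrite wc_ratio_k; ratio_field. Qed.
End weight_ladder.

(** * Coefficients extended by zero and their ladder relations *)

Section weight_poly.
Context {R : realType}.
Variables (L : nat) (nu : R).
Implicit Types (n k i j a b c : nat).

(** Vanishing outside the range lets every sum run over [k < L.+1], so that index shifts need no
    adjustment of bounds depending on [i] and [j]. *)
Definition wcoef k i j : R :=
  if [&& i + j - L <= k, k <= minn i j, i <= L & j <= L]%N then weight_coef L nu k i j else 0.

Lemma wcoef_param k i j : [&& i + j - L <= k, k <= minn i j, i <= L & j <= L]%N ->
  exists a b c, [/\ i = k + a, j = k + b & L = k + a + b + c]%N.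
Proof. by move=> H; exists (i - k)%N, (j - k)%N, (L + k - i - j)%N; split; lia. Qed.

Lemma wcoef_eq0 k i j : ~~ [&& i + j - L <= k, k <= minn i j, i <= L & j <= L]%N -> wcoef k i j = 0.
Proof. by rewrite /wcoef => /negbTE ->. Qed.

Lemma wcoefC k i j : wcoef k i j = wcoef k j i.
Proof.
rewrite /wcoef; have -> : [&& i + j - L <= k, k <= minn i j, i <= L & j <= L]%N =
  [&& j + i - L <= k, k <= minn j i, j <= L & i <= L]%N by lia.
case: ifP => // _; rewrite /weight_coef (addnC j i).
by rewrite (mulrC i`!%:R) (mulrC (pochhammer nu (i - k))) (mulrC ((i - k)`!%:R)) (mulrC ((L - i)`!%:R)).
Qed.

Hypothesis nu_gt0 : 0 < nu.

Lemma wcoefE k a b c : L = (k + a + b + c)%N -> wcoef k (k + a) (k + b) = wc nu k a b c.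
Proof. by move=> LE; rewrite /wcoef ifT; [rewrite LE wcE|rewrite LE; lia]. Qed.

(** The right-hand side collects what row [i] contributes to the Gegenbauer polynomial of degree
    [i.-1 + j - k.*2]: the lower neighbour of term [k] and the upper neighbour of term [k.+1]. *)
Lemma wcoef_down k i j : (0 < i <= L)%N ->
  2 * i%:R * wcoef k i.-1 j =
  wcoef k i j * ((i + j - k.*2)%:R + 2 * nu - 1) * 2 * (i - k)%:R * ((i + j - k)%:R + nu)
     / (((i + j - k.*2)%:R + nu) * (i + j - k.*2)%:R)
  + wcoef k.+1 i j * ((i + j - k.+1.*2).+1)%:R * 2 * k.+1%:R * ((j - k.+1)%:R + nu)
     / (((i + j - k.+1.*2)%:R + nu) * ((i + j - k.+1.*2)%:R + 2 * nu)).
Proof.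
move=> iL; have [H|H] := boolP [&& i.-1 + j - L <= k, k <= minn i.-1 j, i.-1 <= L & j <= L]%N; last first.
  rewrite (wcoef_eq0 H) mulr0 (@wcoef_eq0 k.+1); last by lia.
  rewrite !mul0r addr0; have [ik|ik] := eqVneq i k; first by rewrite ik subnn mulr0 !mul0r.
  by rewrite wcoef_eq0 ?mul0r //; lia.
have [a [b [c [iE jE LE]]]] := wcoef_param H.
have {}iE : i = (k + a).+1 by lia.
rewrite iE jE /= (wcoefE LE).
have -> : ((k + a).+1 + (k + b) - k.*2 = (a + b).+1)%N by lia.
have -> : ((k + a).+1 + (k + b) - k = k + a + b.+1)%N by lia.
have -> : ((k + a).+1 - k = a.+1)%N by lia.
case: b => [|b] in jE LE *.
  rewrite (@wcoef_eq0 k.+1) ?mul0r ?addr0; last by lia.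
  case: c => [|c] in LE *; first by exfalso; lia.
  have E1 : wcoef k (k + a).+1 (k + 0) = wc nu k a.+1 0 c.
    by rewrite -addnS (@wcoefE k a.+1 0 c) //; lia.
  by rewrite E1 wc_down_b0 // addn0 addn1 addnS.
have -> : ((k + a).+1 + (k + b.+1) - k.+1.*2 = a + b)%N by lia.
have -> : (k + b.+1 - k.+1 = b)%N by lia.
rewrite -(addnS a b.+1) -(addnS a b).
have E2 : wcoef k.+1 (k + a).+1 (k + b.+1) = wc nu k.+1 a b c.
  by have := @wcoefE k.+1 a b c; rewrite addnS !addSn; apply; lia.
rewrite E2 {E2}.
case: c => [|c] in LE *.
  rewrite (@wcoef_eq0 k (k + a).+1); last by lia.
  by rewrite !mul0r add0r wc_down_c0.
have E1 : wcoef k (k + a).+1 (k + b.+1) = wc nu k a.+1 b.+1 c.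
  by rewrite -addnS (@wcoefE k a.+1 b.+1 c) //; lia.
by rewrite E1 wc_down.
Qed.

Lemma wcoef_up k i j : (i <= L)%N ->
  2 * (L - i)%:R * wcoef k i.+1 j =
  wcoef k i j * ((i + j - k.*2).+1)%:R * 2 * (k + L - (i + j))%:R * ((i - k)%:R + nu)
     / (((i + j - k.*2)%:R + nu) * ((i + j - k.*2)%:R + 2 * nu))
  + if k is k'.+1 then wcoef k' i j * ((i + j - k'.*2)%:R + 2 * nu - 1) * 2 * (j - k')%:R * ((L - k')%:R + nu)
     / (((i + j - k'.*2)%:R + nu) * (i + j - k'.*2)%:R) else 0.
Proof.
move=> iL; have [H|H] := boolP [&& i.+1 + j - L <= k, k <= minn i.+1 j, i.+1 <= L & j <= L]%N; last first.
  rewrite (wcoef_eq0 H) mulr0.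
  have -> : wcoef k i j * ((i + j - k.*2).+1)%:R * 2 * (k + L - (i + j))%:R = 0.
    have [E|E] := eqVneq (k + L)%N (i + j)%N; first by rewrite E subnn mulr0.
    by rewrite wcoef_eq0 ?mul0r //; lia.
  rewrite !mul0r add0r; case: k => // k in H *.
  have [E|E] := eqVneq j k; first by rewrite E subnn mulr0 !mul0r.
  by rewrite wcoef_eq0 ?mul0r //; lia.
have [a [b [c [iE jE LE]]]] := wcoef_param H.
rewrite jE iE (wcoefE LE).
have -> : (L - i = (b + c).+1)%N by lia.
case: a => [|a] in iE LE *.
  case: k => [|k] in H iE jE LE *; first by exfalso; lia.
  have {}iE : i = k by lia.
  rewrite (@wcoef_eq0 k.+1 i); last by lia.
  rewrite iE !mul0r add0r.
  have -> : (k + (k.+1 + b) - k.*2 = b.+1)%N by lia.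
  have -> : (k.+1 + b - k = b.+1)%N by lia.
  have -> : (L - k = b.+1 + c)%N by lia.
  have -> : wcoef k k (k.+1 + b) = wc nu k 0 b.+1 c.
    by have := @wcoefE k 0 b.+1 c; rewrite addn0 addSn addnS; apply; lia.
  exact: wc_up_a0.
have {}iE : i = (k + a)%N by lia.
rewrite iE.
have -> : (k + a + (k + b) - k.*2 = a + b)%N by lia.
have -> : (k + L - (k + a + (k + b)) = c.+1)%N by lia.
have -> : (k + a - k = a)%N by lia.
rewrite (@wcoefE k a b c.+1); last by lia.
case: k => [|k] in H iE jE LE *; first by rewrite addr0 wc_up_k0.
have -> : (k.+1 + a + (k.+1 + b) - k.*2 = (a + b).+2)%N by lia.
have -> : (k.+1 + b - k = b.+1)%N by lia.
have -> : (L - k = a.+1 + b.+1 + c)%N by lia.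
have -> : wcoef k (k.+1 + a) (k.+1 + b) = wc nu k a.+1 b.+1 c.
  by rewrite !addSnnS (@wcoefE k a.+1 b.+1 c) //; lia.
exact: wc_up.
Qed.
End weight_poly.

Section weight_ladder_poly.
Context {R : realType}.
Variables (L : nat) (nu : R) (nu_gt0 : 0 < nu).
Implicit Types (n k i j a b c : nat).
Local Notation C := (gegenbauer nu).
Local Notation Cp := (gegenbauer_pred nu).
Local Notation wcoef := (wcoef L nu).

Definition weight_poly i j : {poly R} := \sum_(k < L.+1) wcoef k i j *: C (i + j - k.*2).
(* Termwise inversion of the Gegenbauer differential equation, see [weight_prim_ode]; the junk
   value [/ 0] only occurs at [i + j = 2 k], where the derivative vanishes. *)
Definition weight_prim i j : {poly R} := \sum_(k < L.+1)
  (wcoef k i j / ((i + j - k.*2)%:R * ((i + j - k.*2)%:R + 2 * nu))) *: (C (i + j - k.*2))^`().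

Lemma weight_polyE x (i j : 'I_L.+1) :
  weight L nu x i j = (1 - x ^+ 2) `^ (nu - 2^-1) * (weight_poly i j).[x].
Proof.
rewrite mxE; congr (_ * _); rewrite /weight_poly horner_sum.
transitivity (\sum_(0 <= k < L.+1) (wcoef k i j *: C (i + j - k.*2)).[x]); last by rewrite big_mkord.
have iL : (i <= L)%N by rewrite -ltnS.
have jL : (j <= L)%N by rewrite -ltnS.
rewrite [RHS](@big_cat_nat _ _ _ (i + j - L)) //=; last by lia.
rewrite [X in _ = X + _]big1_seq ?add0r; last first.
  move=> k /=; rewrite mem_index_iota => Hk; rewrite wcoef_eq0 ?scale0r ?horner0 //; lia.
rewrite [RHS](@big_cat_nat _ _ _ (minn i j).+1) //=; [|lia..].
rewrite [X in _ = _ + X]big1_seq ?addr0; last first.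
  move=> k /=; rewrite mem_index_iota => Hk; rewrite wcoef_eq0 ?scale0r ?horner0 //; lia.
apply: eq_big_nat => k Hk; rewrite hornerZ /wcoef ifT //; lia.
Qed.

Lemma weight_polyC i j : weight_poly i j = weight_poly j i.
Proof. by apply: eq_bigr => k _; rewrite (wcoefC L nu k i j) (addnC i j). Qed.

Lemma weight_primC i j : weight_prim i j = weight_prim j i.
Proof. by apply: eq_bigr => k _; rewrite (wcoefC L nu k i j) (addnC i j). Qed.

Lemma weight_prim_ode i j : i != j -> (1 - 'X^2) * (weight_prim i j)^`()
   - (2 * nu + 1) *: ('X * weight_prim i j) = - weight_poly i j.
Proof.
move=> ij; rewrite /weight_prim /weight_poly raddf_sum /= !mulr_sumr scaler_sumr -sumrB -sumrN.
apply: eq_bigr => k _; have [->|w0] := eqVneq (wcoef k i j) 0.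
  by rewrite !mul0r !scale0r linear0 !mulr0 scaler0 oppr0 addr0.
have H : [&& i + j - L <= k, k <= minn i j, i <= L & j <= L]%N.
  by move: w0; apply: contraNT => /wcoef_eq0 ->.
set m := (i + j - k.*2)%N.
(* Off the diagonal, [k <= minn i j] forces a positive degree. *)
have m0 : m != 0%N by rewrite /m; lia.
have m1 : (m%:R : R) != 0 by rewrite pnatr_eq0.
have m2 : m%:R + 2 * nu != 0 by rewrite gt_eqF // ltr_wpDl // mulr_gt0.
have O := gegenbauer_ode nu_gt0 m.
transitivity ((wcoef k i j / (m%:R * (m%:R + 2 * nu))) *:
    ((1 - 'X^2) * (C m)^`()^`() - (2 * nu + 1) *: ('X * (C m)^`()))).
  by rewrite derivZ -!mul_polyC; ring.
rewrite (_ : _ - _ = - (m%:R * (m%:R + 2 * nu)) *: C m).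
  rewrite scaleNr scalerN scalerA; congr (- (_ *: _)).
  by field; rewrite m1 m2.
transitivity ((1 - 'X^2) * (C m)^`()^`() - (2 * nu%:P + 1) * 'X * (C m)^`()).
  by rewrite -mul_polyC; ring.
by rewrite O -mul_polyC; ring.
Qed.

(** Both X C_m and (1 - X^2) C_m' are combinations of C_(m+1) and C_(m-1). In the second, the
    factors -m and m + 2 nu cancel one half of the denominator of [s] each. *)
Lemma ladder_term m (p s : R) : (0 < m)%N ->
  (2 * p) *: ('X * C m) + (1 + s / (m%:R * (m%:R + 2 * nu))) *: ((1 - 'X^2) * (C m)^`()) =
  (m.+1%:R / (2 * (m%:R + nu)) * (2 * p - m%:R - s / (m%:R + 2 * nu))) *: C m.+1 +
  ((m%:R + 2 * nu - 1) / (2 * (m%:R + nu)) * (2 * p + (m%:R + 2 * nu) + s / m%:R)) *: Cp m.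
Proof.
move=> m0; have m1 : (m%:R : R) != 0 by rewrite pnatr_eq0 -lt0n.
have m2 : m%:R + 2 * nu != 0 by rewrite gt_eqF // ltr_wpDl // mulr_gt0.
have m3 : m%:R + nu != 0 by rewrite gt_eqF // ltr_wpDl.
have E1 : 'X * C m = (m.+1%:R / (2 * (m%:R + nu))) *: C m.+1
    + ((m%:R + 2 * nu - 1) / (2 * (m%:R + nu))) *: Cp m.
  have c0 : 2 * (m%:R + nu) != 0 by rewrite mulf_neq0 // pnatr_eq0.
  apply: (scalerI c0); rewrite scalerDr !scalerA.
  rewrite mulrCA divff // mulr1 mulrCA divff // mulr1.
  have := gegenbauer_rec nu_gt0 m => G.
  transitivity (m.+1%:R * C m.+1 + (m%:R + 2 * nu%:P - 1) * Cp m).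
    by rewrite G -!mul_polyC; ring.
  by rewrite -!mul_polyC; ring.
have E2 : (1 - 'X^2) * (C m)^`() = (- m%:R * (m.+1%:R / (2 * (m%:R + nu)))) *: C m.+1
    + ((m%:R + 2 * nu) * ((m%:R + 2 * nu - 1) / (2 * (m%:R + nu)))) *: Cp m.
  rewrite deriv_gegenbauer_pred // -mulrA E1.
  transitivity (- m%:R *: (m.+1%:R / (2 * (m%:R + nu)) *: C m.+1
       + (m%:R + 2 * nu - 1) / (2 * (m%:R + nu)) *: Cp m)
     + (m%:R + 2 * nu - 1) *: Cp m).
    by rewrite -!mul_polyC; ring.
  rewrite scalerDr !scalerA -addrA -scalerDl; congr (_ *: _ + _ *: _); by field; rewrite m3.
rewrite E1 E2 !scalerDr !scalerA addrACA -!scalerDl.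
congr (_ *: _ + _ *: _); by field; rewrite ?m1 ?m2 ?m3.
Qed.

Let natr_neq0 m : (0 < m)%N -> (m%:R : R) != 0.
Proof. by rewrite pnatr_eq0 -lt0n. Qed.
Let natr2nu_neq0 m : m%:R + 2 * nu != 0.
Proof. by rewrite gt_eqF // ltr_wpDl // mulr_gt0. Qed.
Let natrnu_neq0 m : m%:R + nu != 0.
Proof. by rewrite gt_eqF // ltr_wpDl. Qed.

Let down_top k i j : R := wcoef k i j * ((i + j - k.*2).+1)%:R * 2 * k%:R * ((j - k)%:R + nu)
  / (((i + j - k.*2)%:R + nu) * ((i + j - k.*2)%:R + 2 * nu)).
Let down_bot k i j : R := wcoef k i j * ((i + j - k.*2)%:R + 2 * nu - 1) * 2 * (i - k)%:R * ((i + j - k)%:R + nu)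
  / (((i + j - k.*2)%:R + nu) * (i + j - k.*2)%:R).
Let up_top k i j : R := wcoef k i j * ((i + j - k.*2).+1)%:R * 2 * (k + L - (i + j))%:R * ((i - k)%:R + nu)
  / (((i + j - k.*2)%:R + nu) * ((i + j - k.*2)%:R + 2 * nu)).
Let up_bot k i j : R := wcoef k i j * ((i + j - k.*2)%:R + 2 * nu - 1) * 2 * (j - k)%:R * ((L - k)%:R + nu)
  / (((i + j - k.*2)%:R + nu) * (i + j - k.*2)%:R).

Let term_down k i j : (i <= L)%N -> (j <= L)%N ->
  wcoef k i j *: ((2 * i%:R) *: ('X * C (i + j - k.*2)) +
    (1 + (i%:R - j%:R) * (i%:R + j%:R + 2 * nu)
         / ((i + j - k.*2)%:R * ((i + j - k.*2)%:R + 2 * nu)))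
      *: ((1 - 'X^2) * (C (i + j - k.*2))^`())) =
  down_top k i j *: C (i + j - k.*2).+1 + down_bot k i j *: Cp (i + j - k.*2).
Proof.
move=> iL jL; rewrite /down_top /down_bot.
have [H|/wcoef_eq0 ->] := boolP [&& i + j - L <= k, k <= minn i j, i <= L & j <= L]%N; last first.
  by rewrite !mul0r !scale0r addr0.
have [a [b [c [-> -> _]]]] := wcoef_param H.
have -> : (k + a + (k + b) - k.*2 = a + b)%N by lia.
have -> : (k + a + (k + b) - k = k + a + b)%N by lia.
have -> : (k + a - k = a)%N by lia.
have -> : (k + b - k = b)%N by lia.
(* [ladder_term] divides by the degree, so degree 0 is checked directly from the explicit
   polynomials of degrees 0 and 1. *)
have [m0|] := posnP (a + b)%N.
  have -> : a = 0%N by lia.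
  have -> : b = 0%N by lia.
  rewrite addn0 /= scaler0 addr0 gegenbauer0 // gegenbauer1 // derivC.
  rewrite !mulr0 scaler0 addr0 mulr1 !scalerA.
  congr (_ *: _); rewrite !add0r; have := nu_gt0 => /lt0r_neq0 n0; by field; rewrite n0.
move=> m0; rewrite ladder_term // scalerDr !scalerA !natrD.
have m1 := natr_neq0 m0; have m2 := natr2nu_neq0 (a + b); have m3 := natrnu_neq0 (a + b).
move: m1 m2 m3; rewrite natrD => m1 m2 m3.
congr (_ *: _ + _ *: _); by field; rewrite ?m1 ?m2 ?m3.
Qed.

Let term_up k i j : (i <= L)%N -> (j <= L)%N ->
  wcoef k i j *: ((2 * (L - i)%:R) *: ('X * C (i + j - k.*2)) +
    (1 + (j%:R - i%:R) * ((L - i)%:R + (L - j)%:R + 2 * nu)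
         / ((i + j - k.*2)%:R * ((i + j - k.*2)%:R + 2 * nu)))
      *: ((1 - 'X^2) * (C (i + j - k.*2))^`())) =
  up_top k i j *: C (i + j - k.*2).+1 + up_bot k i j *: Cp (i + j - k.*2).
Proof.
move=> iL jL; rewrite /up_top /up_bot.
have [H|/wcoef_eq0 ->] := boolP [&& i + j - L <= k, k <= minn i j, i <= L & j <= L]%N; last first.
  by rewrite !mul0r !scale0r addr0.
have [a [b [c [-> -> LE]]]] := wcoef_param H.
have -> : (k + a + (k + b) - k.*2 = a + b)%N by lia.
have -> : (k + a - k = a)%N by lia.
have -> : (k + b - k = b)%N by lia.
have -> : (L - (k + a) = b + c)%N by lia.
have -> : (L - (k + b) = a + c)%N by lia.
have -> : (L - k = a + b + c)%N by lia.
have -> : (k + L - (k + a + (k + b)) = c)%N by lia.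
have [m0|] := posnP (a + b)%N.
  have -> : a = 0%N by lia.
  have -> : b = 0%N by lia.
  rewrite !addn0 /= scaler0 addr0 gegenbauer0 // gegenbauer1 // derivC.
  rewrite !mulr0 scaler0 addr0 mulr1 !scalerA.
  congr (_ *: _); rewrite !add0r; have := nu_gt0 => /lt0r_neq0 n0; by field; rewrite n0.
move=> m0; rewrite ladder_term // scalerDr !scalerA !natrD.
have m1 := natr_neq0 m0; have m2 := natr2nu_neq0 (a + b); have m3 := natrnu_neq0 (a + b).
move: m1 m2 m3; rewrite natrD => m1 m2 m3.
congr (_ *: _ + _ *: _); by field; rewrite ?m1 ?m2 ?m3.
Qed.

Let sum_term (p s : R) i j :
  p *: ('X * weight_poly i j) + (1 - 'X^2) * ((weight_poly i j)^`() + s *: weight_prim i j) =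
  \sum_(k < L.+1) wcoef k i j *: (p *: ('X * C (i + j - k.*2)) +
    (1 + s / ((i + j - k.*2)%:R * ((i + j - k.*2)%:R + 2 * nu)))
      *: ((1 - 'X^2) * (C (i + j - k.*2))^`())).
Proof.
rewrite /weight_poly /weight_prim raddf_sum /= mulr_sumr !scaler_sumr -big_split /= mulr_sumr -big_split /=.
apply: eq_bigr => k _; rewrite derivZ !scalerDr !scalerA -!mul_polyC.
by rewrite !polyCM !polyCD !polyCM; ring.
Qed.

Let wcoef_out k i j : (L < k)%N -> wcoef k i j = 0.
Proof. by move=> kL; apply: wcoef_eq0; lia. Qed.

Let sum_scalerDl n (f g : nat -> R) (h : nat -> {poly R}) :
  \sum_(k < n) (f k + g k) *: h k = \sum_(k < n) f k *: h k + \sum_(k < n) g k *: h k.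
Proof. by rewrite -big_split; apply: eq_bigr => k _; rewrite scalerDl. Qed.

(** The constant (i - j)(i + j + 2 nu) makes the coefficients of [ladder_term] factor. For instance,
    with m = i + j - 2k, the upper one acquires 2i - m - s/(m + 2 nu) = 4k(j - k + nu)/(m + 2 nu),
    which is what [wcoef_down] requires. *)
Lemma weight_poly_down i j : (i <= L)%N -> (j <= L)%N ->
  (2 * i%:R) *: weight_poly i.-1 j = (2 * i%:R) *: ('X * weight_poly i j)
  + (1 - 'X^2) * ((weight_poly i j)^`()
      + ((i%:R - j%:R) * (i%:R + j%:R + 2 * nu)) *: weight_prim i j).
Proof.
move=> iL jL; rewrite sum_term.
under eq_bigr do rewrite term_down //.
case: i => [|i] in iL *.
  rewrite mulr0 scale0r big1 // => k _; rewrite /down_top /down_bot.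
  have [k0|k0] := posnP k; first by rewrite k0 subnn !mulr0 !mul0r !scale0r addr0.
  by rewrite wcoef_eq0 ?mul0r ?scale0r ?addr0 //; lia.
rewrite big_split /= big_ord_recl {1}/down_top !mulr0 !mul0r scale0r add0r.
transitivity (\sum_(k < L.+1) (down_top k.+1 i.+1 j + down_bot k i.+1 j) *: C (i + j - k.*2)).
  rewrite /weight_poly scaler_sumr; apply: eq_bigr => k _.
  rewrite scalerA (wcoef_down nu_gt0 k) //= addrC /down_top /down_bot.
  by [].
rewrite (sum_scalerDl _ (fun k => down_top k.+1 i.+1 j) (fun k => down_bot k i.+1 j)
  (fun k => C (i + j - k.*2))); congr (_ + _).
  (* The shifted sum ends with index [L.+1], whose coefficient is 0. *)
  rewrite big_ord_recr /= {2}/down_top wcoef_out // !mul0r scale0r addr0.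
  apply: eq_bigr => k _; rewrite /bump /= add1n /down_top.
  have [H|/wcoef_eq0 ->] := boolP [&& i.+1 + j - L <= k.+1, k.+1 <= minn i.+1 j, i.+1 <= L & j <= L]%N.
    by congr (_ *: C _); lia.
  by rewrite !mul0r !scale0r.
apply: eq_bigr => k _; rewrite /down_bot.
have [H|/wcoef_eq0 ->] := boolP [&& i.+1 + j - L <= k, k <= minn i.+1 j, i.+1 <= L & j <= L]%N; last first.
  by rewrite !mul0r !scale0r.
have [ik|ik] := eqVneq i.+1 (k : nat); first by rewrite ik subnn !mulr0 !mul0r !scale0r.
have -> : (i.+1 + j - k.*2 = (i + j - k.*2).+1)%N by lia.
by [].
Qed.

(** The constants are those of [weight_poly_down] with [L - i] and [L - j] in place of [i] and
    [j]. *)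
Lemma weight_poly_up i j : (i <= L)%N -> (j <= L)%N ->
  (2 * (L - i)%:R) *: weight_poly i.+1 j = (2 * (L - i)%:R) *: ('X * weight_poly i j)
  + (1 - 'X^2) * ((weight_poly i j)^`()
      + ((j%:R - i%:R) * ((L - i)%:R + (L - j)%:R + 2 * nu)) *: weight_prim i j).
Proof.
move=> iL jL; rewrite sum_term.
under eq_bigr do rewrite term_up //.
rewrite big_split /= [X in _ + X]big_ord_recr /= {2}/up_bot.
have -> : wcoef L i j * ((i + j - L.*2)%:R + 2 * nu - 1) * 2 * (j - L)%:R = 0.
  by rewrite (_ : (j - L = 0)%N) ?mulr0 //; lia.
rewrite !mul0r scale0r addr0.
pose sh (k : nat) : R := if k is k'.+1 then up_bot k' i j else 0.
transitivity (\sum_(k < L.+1) (up_top k i j + sh k) *: C (i.+1 + j - k.*2)).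
  rewrite /weight_poly scaler_sumr; apply: eq_bigr => k _.
  by rewrite scalerA (wcoef_up nu_gt0 k) // /sh /up_top /up_bot.
rewrite (sum_scalerDl _ (fun k => up_top k i j) sh (fun k => C (i.+1 + j - k.*2))); congr (_ + _).
  apply: eq_bigr => k _; rewrite /up_top.
  have [H|/wcoef_eq0 ->] := boolP [&& i + j - L <= k, k <= minn i j, i <= L & j <= L]%N.
    by congr (_ *: C _); lia.
  by rewrite !mul0r !scale0r.
rewrite big_ord_recl /= scale0r add0r; apply: eq_bigr => k _; rewrite /bump /= add1n /up_bot.
have [H|/wcoef_eq0 ->] := boolP [&& i + j - L <= k, k <= minn i j, i <= L & j <= L]%N; last first.
  by rewrite !mul0r !scale0r.
have [jk|jk] := eqVneq j (k : nat); first by rewrite jk subnn !mulr0 !mul0r !scale0r.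
have -> : (i + j - k.*2 = (i.+1 + j - k.+1.*2).+1)%N by lia.
by [].
Qed.
End weight_ladder_poly.

(** * Matrices over a commutative ring *)

Section matrix_ring.
Variables (A : comNzRingType) (n : nat).
Local Notation M := 'M[A]_n.+1.
Implicit Types (c : A) (X Y : M).

Lemma addmxE X Y i j : (X + Y) i j = X i j + Y i j. Proof. by rewrite mxE. Qed.
Lemma oppmxE X i j : (- X) i j = - X i j. Proof. by rewrite mxE. Qed.
Lemma sclmxE c X i j : (c *: X) i j = c * X i j. Proof. by rewrite mxE. Qed.

Lemma trmxD X Y : (X + Y)^T = X^T + Y^T. Proof. by apply/matrixP => i j; rewrite !mxE. Qed.
Lemma trmxN X : (- X)^T = - X^T. Proof. by apply/matrixP => i j; rewrite !mxE. Qed.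
Lemma trmxZ c X : (c *: X)^T = c *: X^T. Proof. by apply/matrixP => i j; rewrite !mxE. Qed.
Lemma trmxM X Y : (X * Y)^T = Y^T * X^T. Proof. exact: trmx_mul. Qed.

Inductive mxexpr :=
  | MxAtom of M
  | MxAdd of mxexpr & mxexpr
  | MxOpp of mxexpr
  | MxScale of A & mxexpr
  | MxMul of mxexpr & mxexpr.

Fixpoint mxexpr_eval e : M := match e with
  | MxAtom X => X
  | MxAdd e1 e2 => mxexpr_eval e1 + mxexpr_eval e2
  | MxOpp e1 => - mxexpr_eval e1
  | MxScale c e1 => c *: mxexpr_eval e1
  | MxMul e1 e2 => mxexpr_eval e1 * mxexpr_eval e2
  end.

Fixpoint mxexpr_lin e (k : seq M -> A) : A := match e with
  | MxAtom X => k [:: X]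
  | MxAdd e1 e2 => mxexpr_lin e1 k + mxexpr_lin e2 k
  | MxOpp e1 => - mxexpr_lin e1 k
  | MxScale c e1 => c * mxexpr_lin e1 k
  | MxMul e1 e2 => mxexpr_lin e1 (fun u => mxexpr_lin e2 (fun v => k (u ++ v)))
  end.

Let mxexpr_linE (G : M -> A) e k : (forall X Y, G (X + Y) = G X + G Y) ->
  (forall c X, G (c *: X) = c * G X) -> (forall u, k u = G (\prod_(X <- u) X)) ->
  mxexpr_lin e k = G (mxexpr_eval e).
Proof.
elim: e G k => [X|e1 IH1 e2 IH2|e IH|c e IH|e1 IH1 e2 IH2] G k GD GZ kG /=.
- by rewrite kG big_seq1.
- by rewrite GD (IH1 G) // (IH2 G).
- by rewrite (IH G) // -scaleN1r GZ mulN1r.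
- by rewrite (IH G) // GZ.
apply: (IH1 (fun X => G (X * mxexpr_eval e2))) => [X Y|c X|u].
- by rewrite mulrDl GD.
- by rewrite -scalerAl GZ.
apply: (IH2 (fun Y => G (_ * Y))) => [X Y|c X|v].
- by rewrite mulrDr GD.
- by rewrite -scalerAr GZ.
- by rewrite kG big_cat.
Qed.

(* [mxexpr_lin e k] is the value at [e] of the linear form on the free algebra that sends
   each word [u] to [k u], so the hypothesis is an identity in the free algebra. *)
Lemma mxexpr_eq e1 e2 : (forall k, mxexpr_lin e1 k = mxexpr_lin e2 k) ->
  mxexpr_eval e1 = mxexpr_eval e2.
Proof.
move=> E; apply/matrixP => i j; have := E (fun u => (\prod_(X <- u) X) i j).
by rewrite !(mxexpr_linE (G := fun X => X i j)) // => *; rewrite (addmxE, sclmxE).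
Qed.
End matrix_ring.

Ltac mxreify T := lazymatch T with
  | ?X + ?Y => let a := mxreify X in let b := mxreify Y in constr:(MxAdd a b)
  | - ?X => let a := mxreify X in constr:(MxOpp a)
  | ?c *: ?X => let a := mxreify X in constr:(MxScale c a)
  | ?X * ?Y => let a := mxreify X in let b := mxreify Y in constr:(MxMul a b)
  | _ => constr:(MxAtom T)
  end.

(** After [cbn] both sides are linear in the values of [k] on words of atoms, and [ring] treats
    these values as variables. *)
Ltac mxring := match goal with |- ?X = ?Y =>
  let a := mxreify X in let b := mxreify Y in
  apply: (@mxexpr_eq _ _ a b) => k; cbn [mxexpr_lin cat]; ring end.

(** Write X = tau p - mu q and E = q^2 - p^2 + mu^2 - tau^2. If X = 0, the first equation gives E =
    0, and then (mu^2 - tau^2)(mu^2 - p^2) = 0, which is impossible. Otherwise eliminating E and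
    dividing by X gives a relation T in which p and q mix only through the product pq; eliminating
    pq between T and the first equation leaves (mu^2 - (tau + 2)^2)(p^2 + q^2 - mu^2 - tau^2) = 0,
    with both factors nonzero. *)
Lemma mirror_contradiction (R : realFieldType) (tau mu p q : R) :
  `|p| < tau -> `|q| < tau -> tau + 2 < mu ->
  (tau * p - mu * q) * ((tau + 2) * q - mu * p) + mu * (q ^+ 2 - p ^+ 2 + (mu ^+ 2 - tau ^+ 2)) = 0 ->
  (tau * p - mu * q) * (mu ^+ 2 - tau ^+ 2 - 4 * tau - (q ^+ 2 - p ^+ 2))
     - 2 * p * (q ^+ 2 - p ^+ 2 + (mu ^+ 2 - tau ^+ 2)) = 0 -> False.
Proof.
move=> pt qt tm E1 E2.
have t0 : 0 < tau by exact: le_lt_trans pt.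
have m0 : 0 < mu by lra.
have p2 : p ^+ 2 < tau ^+ 2 by rewrite -[p ^+ 2]real_normK ?num_real // ltrXn2r ?nnegrE // ltW.
have q2 : q ^+ 2 < tau ^+ 2 by rewrite -[q ^+ 2]real_normK ?num_real // ltrXn2r ?nnegrE // ltW.
have tm2 : tau ^+ 2 < mu ^+ 2 by rewrite ltrXn2r ?nnegrE //; lra.
have tm3 : (tau + 2) ^+ 2 < mu ^+ 2 by rewrite ltrXn2r ?nnegrE //; lra.
have X0 : tau * p - mu * q != 0.
  apply/negP => /eqP X0; move: E1; rewrite X0 mul0r add0r => /eqP.
  rewrite mulf_eq0 (gt_eqF m0) /= => /eqP E.
  have : (mu ^+ 2 - tau ^+ 2) * (mu ^+ 2 - p ^+ 2) = 0.
    transitivity (mu ^+ 2 * (q ^+ 2 - p ^+ 2 + (mu ^+ 2 - tau ^+ 2))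
      + (tau * p - mu * q) * (tau * p + mu * q)); first by ring.
    by rewrite E X0 mulr0 mul0r addr0.
  by apply/eqP; rewrite mulf_neq0 // subr_eq0 gt_eqF //; lra.
have T : mu * (mu ^+ 2 - tau ^+ 2 - 4 * tau - q ^+ 2 - p ^+ 2) + 2 * (tau + 2) * p * q = 0.
  apply: (mulfI X0); rewrite mulr0.
  transitivity (mu * ((tau * p - mu * q) * (mu ^+ 2 - tau ^+ 2 - 4 * tau - (q ^+ 2 - p ^+ 2))
     - 2 * p * (q ^+ 2 - p ^+ 2 + (mu ^+ 2 - tau ^+ 2)))
   + 2 * p * ((tau * p - mu * q) * ((tau + 2) * q - mu * p)
              + mu * (q ^+ 2 - p ^+ 2 + (mu ^+ 2 - tau ^+ 2)))).
    by ring.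
  by rewrite E1 E2 !mulr0 addr0.
have : mu * ((mu ^+ 2 - (tau + 2) ^+ 2) * (p ^+ 2 + q ^+ 2 - mu ^+ 2 - tau ^+ 2)) = 0.
  transitivity (2 * (tau + 2) * ((tau * p - mu * q) * ((tau + 2) * q - mu * p)
        + mu * (q ^+ 2 - p ^+ 2 + (mu ^+ 2 - tau ^+ 2)))
    - (tau ^+ 2 + 2 * tau + mu ^+ 2)
      * (mu * (mu ^+ 2 - tau ^+ 2 - 4 * tau - q ^+ 2 - p ^+ 2) + 2 * (tau + 2) * p * q)).
    by ring.
  by rewrite E1 T !mulr0 subr0.
apply/eqP; rewrite mulf_neq0 ?(gt_eqF m0) // mulf_neq0 //; first by rewrite subr_eq0 gt_eqF.
by rewrite lt_eqF //; lra.
Qed.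

(** * The sl2 matrices and their commutation relations *)

Section ladder_matrices.
Variables (A : comNzRingType) (L : nat).
Local Notation M := 'M[A]_L.+1.

(* The (L + 1)-dimensional representation of sl2: [Hmx] is a Cartan element, [Cmx] and [Fmx] are
   the sum and the difference of the ladder operators. *)
Definition Hmx : M := \matrix_(i, j) ((L%:R - 2 * i%:R) *+ (i == j)).
Definition Cmx : M := \matrix_(i, j) (i%:R *+ (j.+1 == i) + (L - i)%:R *+ (j == i.+1 :> nat)).
Definition Fmx : M := \matrix_(i, j) (i%:R *+ (j.+1 == i) - (L - i)%:R *+ (j == i.+1 :> nat)).

Lemma mul_Hmx (X : M) i j : (Hmx * X) i j = (L%:R - 2 * i%:R) * X i j.
Proof.
rewrite mxE (bigD1 i) //= mxE eqxx mulr1n big1 ?addr0 // => k ki.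
by rewrite mxE eq_sym (negbTE ki) mulr0n mul0r.
Qed.

Lemma mulmx_H (X : M) i j : (X * Hmx) i j = X i j * (L%:R - 2 * j%:R).
Proof.
rewrite mxE (bigD1 j) //= mxE eqxx mulr1n big1 ?addr0 // => k ki.
by rewrite mxE (negbTE ki) mulr0n mulr0.
Qed.

Lemma trmx_H : Hmx^T = Hmx.
Proof. by apply/matrixP => i j; rewrite !mxE eq_sym; case: eqP => // ->. Qed.

Lemma Hmx_Cmx : Hmx * Cmx - Cmx * Hmx + 2 *: Fmx = 0.
Proof.
apply/matrixP => i j; rewrite !(addmxE, oppmxE, sclmxE) mul_Hmx mulmx_H !mxE.
have [ji|ji] := eqVneq (j.+1) (i : nat).
  rewrite (_ : (j == i.+1 :> nat) = false) ?mulr0n ?mulr1n; last by apply/eqP; lia.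
  by rewrite -ji -natr1; ring.
have [ij|ij] := eqVneq (j : nat) i.+1; last by rewrite !mulr0n; ring.
by rewrite mulr0n mulr1n ij -natr1; ring.
Qed.

Lemma Hmx_Fmx : Hmx * Fmx - Fmx * Hmx + 2 *: Cmx = 0.
Proof.
apply/matrixP => i j; rewrite !(addmxE, oppmxE, sclmxE) mul_Hmx mulmx_H !mxE.
have [ji|ji] := eqVneq (j.+1) (i : nat).
  rewrite (_ : (j == i.+1 :> nat) = false) ?mulr0n ?mulr1n; last by apply/eqP; lia.
  by rewrite -ji -natr1; ring.
have [ij|ij] := eqVneq (j : nat) i.+1; last by rewrite !mulr0n; ring.
by rewrite mulr0n mulr1n ij -natr1; ring.
Qed.

Lemma Hmx_trCmx : Hmx * Cmx^T - Cmx^T * Hmx - 2 *: Fmx^T = 0.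
Proof.
have := congr1 trmx Hmx_Cmx; rewrite !linearD linearN linearZ /= !trmxM trmx_H trmx0 => h.
by rewrite -oppr0 -h; apply/matrixP => i j; rewrite !(addmxE, oppmxE, sclmxE); ring.
Qed.

Lemma Hmx_trFmx : Hmx * Fmx^T - Fmx^T * Hmx - 2 *: Cmx^T = 0.
Proof.
have := congr1 trmx Hmx_Fmx; rewrite !linearD linearN linearZ /= !trmxM trmx_H trmx0 => h.
by rewrite -oppr0 -h; apply/matrixP => i j; rewrite !(addmxE, oppmxE, sclmxE); ring.
Qed.
End ladder_matrices.

(* [h0], [hd] are the two differential equations for [P], with [S], [S1], [S2] its derivatives, and
   [h1], [hd1] the differentiated equations; [e], [d] are the equations satisfied by the transpose
   of a solution, evaluated at [P], and [e1], [e2] the derivatives of [e]. When [P'] is symmetric,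
   [e] and [d] are constant multiples of the antisymmetric part of [P] in each entry. *)
Section mirror_identities.
Variables (A : comNzRingType) (l : nat).
Local Notation M := 'M[A]_l.+1.
Variables (H F Ft C Ct : M).
Hypotheses (HC : H * C - C * H + 2 *: F = 0) (HF : H * F - F * H + 2 *: C = 0)
  (HCt : H * Ct - Ct * H - 2 *: Ft = 0) (HFt : H * Ft - Ft * H - 2 *: Ct = 0).
Variables (x tau n : A).
Let mu := tau + 2 * n.
Let b := x *: H + F.
Let bt := x *: H + Ft.
Variables (P S S1 S2 : M).

Let h0 := 2 *: (S * b) + tau *: (P * H) - mu *: (H * P).
Let h1 := 2 *: (S1 * b) + (tau + 2) *: (S * H) - mu *: (H * S).
Let hd := (4 * (1 - x ^+ 2)) *: S1 + 4 *: (S * C) - (4 * (tau + 1) * x) *: S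
  - (P * H * H - H * H * P) + (4 * n * (n + tau)) *: P.
Let hd1 := (4 * (1 - x ^+ 2)) *: S2 - (8 * x) *: S1 + 4 *: (S1 * C) - (4 * (tau + 1) * x) *: S1
  - (4 * (tau + 1)) *: S - (S * H * H - H * H * S) + (4 * n * (n + tau)) *: S.

Let e := 2 *: (bt * S) + tau *: (H * P) - mu *: (P * H).
Let e1 := 2 *: (H * S) + 2 *: (bt * S1) + tau *: (H * S) - mu *: (S * H).
Let e2 := 4 *: (H * S1) + 2 *: (bt * S2) + tau *: (H * S1) - mu *: (S1 * H).
Let d := (4 * (1 - x ^+ 2)) *: S1 + 4 *: (Ct * S) - (4 * (tau + 1) * x) *: S
  + (P * H * H - H * H * P) + (4 * n * (n + tau)) *: P.

(** Left and right multiplications commute, so the product bt S1 b occurs in both [bt * h1] and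
    [e1 * b] and cancels in their difference. The multiples of [h0] and [hd] and the commutators of
    H with F and Ft absorb the rest. *)
Lemma mirror_first_order : h0 = 0 -> h1 = 0 -> hd = 0 -> e1 = 0 ->
  (tau + 2) *: (e * H) - mu *: (H * e) + mu *: d = 0.
Proof.
move=> h00 h10 hd0 e10.
have -> : (tau + 2) *: (e * H) - mu *: (H * e) + mu *: d =
  (tau + 2) *: (H * h0) + 2 *: (bt * h1) - mu *: (h0 * H) + mu *: hd - 2 *: (e1 * b)
  - (2 * mu) *: (S * (H * F - F * H + 2 *: C)) - (2 * mu) *: ((H * Ft - Ft * H - 2 *: Ct) * S).
  rewrite /e /h0 /h1 /e1 /hd /d /b /bt /mu.
  mxring.
by rewrite h00 h10 hd0 e10 HF HFt !(mulr0, mul0r, scaler0, addr0, oppr0).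
Qed.

(** The same principle with the second-order equation: bt S2 cancels between [bt * hd1] and [e2],
    and bt S1 C between [bt * hd1] and [e1 * C]. *)
Lemma mirror_second_order : h0 = 0 -> hd = 0 -> hd1 = 0 -> e1 = 0 -> e2 = 0 ->
  (4 * n * (n + tau) - 4 * tau) *: e - (e * H * H - H * H * e) - 2 *: (H * d) = 0.
Proof.
move=> h00 hd0 hd10 e10 e20.
have -> : (4 * n * (n + tau) - 4 * tau) *: e - (e * H * H - H * H * e) - 2 *: (H * d) =
  2 *: (bt * hd1) + tau *: (H * hd) - mu *: (hd * H) + 2 *: (H * hd) + (8 * x) *: e1
  + (4 * mu) *: h0 - (4 * (1 - x ^+ 2)) *: e2 - 4 *: (e1 * C) + (4 * (tau + 1) * x) *: e1
  - (4 * mu) *: (S * (H * C - C * H + 2 *: F))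
  + 2 *: ((H * (H * Ft - Ft * H - 2 *: Ct) + (H * Ft - Ft * H - 2 *: Ct) * H) * S)
  - 4 *: ((H * Ct - Ct * H - 2 *: Ft) * S).
  rewrite /e /h0 /hd1 /e1 /e2 /hd /d /b /bt /mu.
  mxring.
by rewrite h00 hd0 hd10 e10 e20 HC HFt HCt !(mulr0, mul0r, scaler0, addr0, oppr0).
Qed.
End mirror_identities.

(** * Matrices of polynomials and the two eigenvalue equations *)

Section polynomial_matrices.
Variables (K : numFieldType) (L : nat).
Local Notation M := 'M[{poly K}]_L.+1.
Implicit Types (X Y P : M).

Definition dmx X : M := map_mx (@deriv K) X.

Lemma dmxE X i j : dmx X i j = (X i j)^`(). Proof. by rewrite mxE. Qed.

Lemma dmxD X Y : dmx (X + Y) = dmx X + dmx Y.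
Proof. by apply/matrixP => i j; rewrite !mxE derivD. Qed.
Lemma dmxN X : dmx (- X) = - dmx X.
Proof. by apply/matrixP => i j; rewrite !mxE derivN. Qed.
Lemma dmxZ c X : dmx (c *: X) = c^`() *: X + c *: dmx X.
Proof. by apply/matrixP => i j; rewrite !mxE derivM. Qed.
Lemma dmxM X Y : dmx (X * Y) = dmx X * Y + X * dmx Y.
Proof.
apply/matrixP => i j; rewrite !mxE raddf_sum -big_split /=.
by apply: eq_bigr => k _; rewrite !mxE derivM.
Qed.
Lemma dmx_tr X : dmx X^T = (dmx X)^T.
Proof. by apply/matrixP => i j; rewrite !mxE. Qed.

Lemma deriv_natr n : (n%:R : {poly K})^`() = 0.
Proof. by rewrite -polyC_natr derivC. Qed.

Lemma dmx_H : dmx (Hmx _ L) = 0.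
Proof.
apply/matrixP => i j; rewrite !mxE derivMn derivB derivM !deriv_natr.
by rewrite mul0r mulr0 addr0 subr0 mul0rn.
Qed.
Lemma dmx_F : dmx (Fmx _ L) = 0.
Proof. by apply/matrixP => i j; rewrite !mxE derivB !derivMn -polyC1 !derivC !mul0rn subr0. Qed.
Lemma dmx_C : dmx (Cmx _ L) = 0.
Proof. by apply/matrixP => i j; rewrite !mxE derivD !derivMn -polyC1 !derivC !mul0rn addr0. Qed.

Local Notation H := (Hmx {poly K} L).
Local Notation F := (Fmx {poly K} L).
Local Notation C := (Cmx {poly K} L).

(* The eigenvalue equations of the operators [Eop] and [Dop] below. *)
Definition opE (tau n : {poly K}) P : M :=
  2 *: (dmx P * ('X *: H + F)) + tau *: (P * H) - (tau + 2 * n) *: (H * P).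
Definition opD (tau n : {poly K}) P : M :=
  (4 * (1 - 'X ^+ 2)) *: dmx (dmx P) + 4 *: (dmx P * C) - (4 * (tau + 1) * 'X) *: dmx P
  - (P * H * H - H * H * P) + (4 * n * (n + tau)) *: P.

Lemma dmx_opE (t m : K) P : dmx (opE t%:P m%:P P) = opE (t + 2)%:P (m - 1)%:P (dmx P).
Proof.
rewrite /opE !(dmxD, dmxN, dmxZ, dmxM) dmx_H dmx_F !(derivD, derivM, derivC, derivX, deriv_natr).
apply/matrixP => i j.
rewrite !(mulrDr, mulr0, mul0r, addr0, scaler0, add0r, scale0r) !(addmxE, oppmxE, sclmxE).
by rewrite -!scalerAr !(addmxE, oppmxE, sclmxE); ring.
Qed.

Lemma dmx_opD (t m : K) P : dmx (opD t%:P m%:P P) = opD (t + 2)%:P (m - 1)%:P (dmx P).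
Proof.
rewrite /opD !(dmxD, dmxN, dmxZ, dmxM) dmx_H dmx_C.
rewrite !(derivD, derivM, derivN, derivC, derivX, derivXn, deriv_natr).
apply/matrixP => i j.
rewrite !(mulr0, mul0r, addr0, scaler0, add0r, scale0r) !(addmxE, oppmxE, sclmxE).
ring.
Qed.
End polynomial_matrices.

(** * Symmetry of the solutions of the two equations *)

Section mirror_symmetry.
Variables (R : realFieldType) (K : numFieldType) (f : {rmorphism R -> K}) (L : nat).
Local Notation M := 'M[{poly K}]_L.+1.
Local Notation H := (Hmx {poly K} L).
Local Notation F := (Fmx {poly K} L).
Local Notation C := (Cmx {poly K} L).
Implicit Types (P : M) (tau mu : R) (c : K) (i j : 'I_L.+1).

Let h i : R := L%:R - 2 * i%:R.

Let h_le i : `|h i| <= L%:R.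
Proof.
have : (i%:R : R) <= L%:R by rewrite ler_nat -ltnS.
have : 0 <= (i%:R : R) by [].
by rewrite /h ler_norml; lra.
Qed.

Let hE i : L%:R - 2 * i%:R = (f (h i))%:P :> {poly K}.
Proof. by rewrite /h rmorphB rmorphM !rmorph_nat polyCB polyCM !polyC_natr. Qed.

Let opE_entry (t m : {poly K}) P i j : opE t m P i j =
  2 * (dmx P * ('X *: H + F)) i j + t * (P i j * (f (h j))%:P) - (t + 2 * m) * ((f (h i))%:P * P i j).
Proof. by rewrite /opE !(addmxE, oppmxE, sclmxE) mulmx_H mul_Hmx !hE. Qed.

Lemma mirror_step tau n P : L%:R < tau -> (1 < n)%N ->
  opE (f tau)%:P n%:R%:P P = 0 -> opD (f tau)%:P n%:R%:P P = 0 ->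
  (dmx P)^T = dmx P -> P^T = P.
Proof.
move=> Lt n1 hE0 hD0 symS.
set t := (f tau)%:P in hE0 hD0; set m := n%:R%:P in hE0 hD0.
have hE1 := congr1 (@dmx K L) hE0; have hD1 := congr1 (@dmx K L) hD0.
rewrite dmx_opE in hE1; rewrite dmx_opD in hD1.
have dm0 : dmx (0 : M) = 0 by apply/matrixP => i j; rewrite !mxE derivC.
rewrite dm0 in hE1 hD1.
set S := dmx P in symS hE1 hD1; set S1 := dmx S in hE1 hD1; set S2 := dmx S1 in hD1.
pose A := P - P^T.
have dA : dmx A = 0 by rewrite /A dmxD dmxN dmx_tr symS subrr.
pose e := 2 *: (('X *: H + F^T) * S) + t *: (H * P) - (t + 2 * m) *: (P * H).
(* Transposing the equation replaces [P] by its transpose and keeps [S], so subtraction leaves only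
   [A]; [dE] arises in the same way. *)
have eA : e = t *: (H * A) - (t + 2 * m) *: (A * H).
  have := congr1 trmx hE0; rewrite /opE trmx0 !(trmxD, trmxN, trmxZ, trmxM) trmx_H symS => h0.
  rewrite -[LHS]subr0 -h0 /e /A !mulrDr !mulrDl !mulrN !mulNr.
  by apply/matrixP => i j; rewrite !(addmxE, oppmxE, sclmxE); ring.
pose d := (4 * (1 - 'X ^+ 2)) *: S1 + 4 *: (C^T * S) - (4 * (t + 1) * 'X) *: S
  + (P * H * H - H * H * P) + (4 * m * (m + t)) *: P.
have symS1 : S1^T = S1 by rewrite /S1 -dmx_tr symS.
have dE : d = (A * H * H - H * H * A) + (4 * m * (m + t)) *: A.
  have := congr1 trmx hD0; rewrite /opD trmx0 !(trmxD, trmxN, trmxZ, trmxM) trmx_H symS1 symS !mulrA => h0.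
  rewrite -[LHS]subr0 -h0 /d /A !mulrDr !mulrDl !mulrN !mulNr.
  by apply/matrixP => i j; rewrite !(addmxE, oppmxE, sclmxE); ring.
(* By [eA] the matrix [e] is constant, because [A] is; its derivative therefore vanishes. *)
have e1 : 2 *: (H * S) + 2 *: (('X *: H + F^T) * S1) + t *: (H * S) - (t + 2 * m) *: (S * H) = 0.
  have dt : t^`() = 0 by rewrite derivC.
  have dm : (t + 2 * m)^`() = 0 by rewrite derivD derivM dt derivC deriv_natr mul0r mulr0 !addr0.
  have dF : dmx F^T = 0 by rewrite dmx_tr dmx_F trmx0.
  have := congr1 (@dmx K L) eA; rewrite /e; clearbody A.
  rewrite !(dmxD, dmxN, dmxZ, dmxM) dmx_H dF dA dt dm deriv_natr derivX -/S -/S1.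
  rewrite !(mulr0, mul0r, scaler0, scale0r, addr0, add0r, oppr0) scale1r => <-.
  rewrite ?mulrDr ?mulrDl ?scalerDr.
  by apply/matrixP => i j; rewrite !(addmxE, oppmxE, sclmxE); ring.
have e2 : 4 *: (H * S1) + 2 *: (('X *: H + F^T) * S2) + t *: (H * S1) - (t + 2 * m) *: (S1 * H) = 0.
  have dt : t^`() = 0 by rewrite derivC.
  have dm : (t + 2 * m)^`() = 0 by rewrite derivD derivM dt derivC deriv_natr mul0r mulr0 !addr0.
  have dF : dmx F^T = 0 by rewrite dmx_tr dmx_F trmx0.
  have := congr1 (@dmx K L) e1; rewrite dm0.
  rewrite !(dmxD, dmxN, dmxZ, dmxM) dmx_H dF dt dm deriv_natr derivX -/S1 -/S2.
  rewrite !(mulr0, mul0r, scaler0, scale0r, addr0, add0r, oppr0) scale1r => <-.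
  rewrite ?mulrDr ?mulrDl ?scalerDr.
  by apply/matrixP => i j; rewrite !(addmxE, oppmxE, sclmxE); ring.
have h1 : 2 *: (S1 * ('X *: H + F)) + (t + 2) *: (S * H) - (t + 2 * m) *: (H * S) = 0.
  rewrite -hE1 /opE; apply/matrixP => i j; rewrite !(addmxE, oppmxE, sclmxE).
  by rewrite /t /m; ring.
have hd1 : (4 * (1 - 'X ^+ 2)) *: S2 - (8 * 'X) *: S1 + 4 *: (S1 * C) - (4 * (t + 1) * 'X) *: S1
  - (4 * (t + 1)) *: S - (S * H * H - H * H * S) + (4 * m * (m + t)) *: S = 0.
  rewrite -hD1 /opD; apply/matrixP => i j; rewrite !(addmxE, oppmxE, sclmxE).
  by rewrite /t /m; ring.
have Ft := Hmx_trFmx {poly K} L; have Ct := Hmx_trCmx {poly K} L.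
have HC := Hmx_Cmx {poly K} L; have HF := Hmx_Fmx {poly K} L.
have M1 : (t + 2) *: (e * H) - (t + 2 * m) *: (H * e) + (t + 2 * m) *: d = 0 :=
  mirror_first_order HF Ft hE0 h1 hD0 e1.
have M2 : (4 * m * (m + t) - 4 * t) *: e - (e * H * H - H * H * e) - 2 *: (H * d) = 0 :=
  mirror_second_order HC Ct Ft hE0 hD0 hd1 e1 e2.
clearbody e d.
apply/eqP; rewrite eq_sym -subr_eq0 -/A; apply/eqP/matrixP => i j; rewrite [RHS]mxE.
clearbody A; set p := h i; set q := h j.
have eij : e i j = A i j * (f (tau * p - (tau + 2 * n%:R) * q))%:P.
  rewrite eA !(addmxE, oppmxE, sclmxE) mul_Hmx mulmx_H !hE -/p -/q /t /m.
  ring.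
have dij : d i j = A i j * (f (q ^+ 2 - p ^+ 2 + 4 * n%:R * (n%:R + tau)))%:P.
  rewrite dE !(addmxE, oppmxE, sclmxE) !mulmx_H -(mulrA H H) !mul_Hmx !hE -/p -/q /t /m.
  ring.
have [//|A0] := eqVneq (A i j) 0; exfalso.
(* Each identity becomes [A i j] times the image of an element of the ordered field [R]; a nonzero
   entry turns it into an equation over [R], where inequalities are available. *)
have cst (x : R) : A i j * (f x)%:P = 0 -> x = 0.
  move=> /eqP; rewrite mulf_eq0 (negbTE A0) polyC_eq0 fmorph_eq0 => /eqP //.
pose mu := tau + 2 * n%:R.
have n4 : 4 * n%:R * (n%:R + tau) = mu ^+ 2 - tau ^+ 2 by rewrite /mu; ring.
have n2 : (2 : R) <= n%:R by rewrite (ler_nat R 2 n).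
apply: (@mirror_contradiction R tau mu p q).
- exact: le_lt_trans (h_le i) Lt.
- exact: le_lt_trans (h_le j) Lt.
- by rewrite /mu; lra.
- apply: cst; have := congr1 (fun X : M => X i j) M1.
  rewrite !(addmxE, oppmxE, sclmxE) mul_Hmx mulmx_H !hE -/p -/q eij dij mxE n4 -/mu => <-.
  rewrite /t /m /mu; ring.
- apply: cst; have := congr1 (fun X : M => X i j) M2.
  rewrite !(addmxE, oppmxE, sclmxE) mul_Hmx !mulmx_H -(mulrA H H) !mul_Hmx !hE.
  rewrite -/p -/q eij dij mxE n4 -/mu => <-.
  rewrite /t /m /mu; ring.
Qed.

(** Here [mu = tau + 2]. The constant coefficient of the first-order equation determines the
    off-diagonal entries of P(0) from the leading coefficient, and [HD] is the cross-multiplied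
    statement that they are symmetric. *)
Lemma mirror_base tau c (D : 'I_L.+1 -> K) P : L%:R < tau ->
  (forall i j, D i * (Fmx K L i j * f (tau * h i - (tau + 2) * h j)) =
               D j * (Fmx K L j i * f (tau * h j - (tau + 2) * h i))) ->
  opE (f tau)%:P 1%:P P = 0 ->
  (forall i j, (size (P i j) <= 2)%N) ->
  (forall i j, (P i j)`_1 = (c * D i) *+ (i == j)) -> P^T = P.
Proof.
move=> Lt HD E0 szP P1.
pose X i j := (P i j)`_0.
have PE i j : P i j = ((c * D i) *+ (i == j))%:P * 'X + (X i j)%:P.
  apply/polyP => k; rewrite coefD coefMX !coefC.
  case: k => [|[|k]] /=.
  - by rewrite add0r.
  - by rewrite addr0 P1.
  - by rewrite addr0 nth_default // (leq_trans (szP i j)).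
have dP i j : dmx P i j = ((c * D i) *+ (i == j))%:P.
  by rewrite dmxE PE derivD derivM !derivC derivX mul0r add0r mulr1 addr0.
have eqX i j : X i j * f (tau * h j - (tau + 2) * h i) = - (2 * c * (D i * Fmx K L i j)).
  have := congr1 (fun Y : M => (Y i j)`_0) E0; rewrite opE_entry [RHS](_ : _ = 0); last by rewrite mxE coef0.
  have -> : (dmx P * ('X *: H + F)) i j = (c * D i)%:P * ('X * H i j + F i j).
    rewrite mxE (bigD1 i) //= big1 ?addr0 => [|k ki].
      by rewrite dP eqxx mulr1n !mxE.
    by rewrite dP eq_sym (negbTE ki) mulr0n mul0r.
  have F0 : (F i j)`_0 = Fmx K L i j by rewrite !mxE coefB !coefMn !coef1.
  rewrite -horner_coef0 !hornerE !horner_coef0 F0 -/(X i j) => h0.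
  have {}h0 : 2 * c * D i * Fmx K L i j + f tau * X i j * f (h j) - (f tau + 2) * (f (h i) * X i j) = 0.
    by rewrite -[RHS]h0 /=; ring.
  apply: (addIr (2 * c * D i * Fmx K L i j)); rewrite /= [RHS]addNr -[RHS]h0.
  by ring.
apply/matrixP => i j; rewrite mxE !PE (eq_sym j).
have [->//|ij] := eqVneq i j.
rewrite !mulr0n mul0r !add0r; congr (_%:P).
(* If this vanished, then [h a = tau * (a - b)], contrary to |h a| <= L < tau. *)
have g0 a b : a != b -> f (tau * h b - (tau + 2) * h a) != 0.
  move=> ab; rewrite fmorph_eq0; apply/eqP => E.
  have := h_le a; rewrite ler_norml => /andP[ha1 ha2].
  have : (a < b)%N || (b < a)%N by rewrite -neq_ltn.
  have hab : h b = h a + 2 * (a%:R - b%:R) by rewrite /h; ring.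
  rewrite hab in E.
  case/orP => lt_ab.
    have : (a%:R + 1 : R) <= b%:R by rewrite natr1 ler_nat.
    nra.
  have : (b%:R + 1 : R) <= a%:R by rewrite natr1 ler_nat.
  nra.
apply: (mulIf (g0 _ _ ij)); rewrite eq_sym in ij; apply: (mulIf (g0 _ _ ij)).
rewrite eqX mulrAC eqX !mulNr; congr (- _).
by rewrite -!mulrA; congr (_ * (_ * _)); rewrite HD.
Qed.

(** [HD] depends on [tau] and [n] only through [tau + 2 * n], which differentiation preserves, so
    one [D] serves down to degree 1. The scalar [c] collects the factors that differentiation puts
    on the leading coefficient. *)
Theorem mirror_symmetric n tau c (D : 'I_L.+1 -> K) P : L%:R < tau ->
  (forall i j, D i * (Fmx K L i j * f ((tau + 2 * n%:R - 2) * h i - (tau + 2 * n%:R) * h j)) =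
               D j * (Fmx K L j i * f ((tau + 2 * n%:R - 2) * h j - (tau + 2 * n%:R) * h i))) ->
  opE (f tau)%:P n%:R%:P P = 0 -> opD (f tau)%:P n%:R%:P P = 0 ->
  (forall i j, (size (P i j) <= n.+1)%N) ->
  (forall i j, (P i j)`_n = (c * D i) *+ (i == j)) -> P^T = P.
Proof.
elim: n tau c P => [|n IH] tau c P Lt HD E0 D0 szP Pn.
  apply/matrixP => i j; rewrite mxE.
  rewrite (size1_polyC (szP j i)) (size1_polyC (szP i j)) !Pn (eq_sym j).
  by have [->|] := eqVneq i j.
case: n IH HD E0 D0 szP Pn => [|n] IH HD E0 D0 szP Pn.
  apply: (mirror_base Lt (D := D) (c := c)) => // i j.
  by have := HD i j; rewrite mulr1 addrK.
apply: (mirror_step Lt _ E0 D0) => //.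
apply: (IH (tau + 2) (c * n.+2%:R)).
- lra.
- move=> i j; have := HD i j.
  by have -> : tau + 2 * n.+2%:R = tau + 2 + 2 * n.+1%:R by rewrite -!natr1; ring.
- have := congr1 (@dmx K L) E0; rewrite dmx_opE.
  have -> : dmx (0 : M) = 0 by apply/matrixP => i j; rewrite !mxE derivC.
  by rewrite (rmorphD f) (rmorph_nat f) -(natr1 n.+1) addrK.
- have := congr1 (@dmx K L) D0; rewrite dmx_opD.
  have -> : dmx (0 : M) = 0 by apply/matrixP => i j; rewrite !mxE derivC.
  by rewrite (rmorphD f) (rmorph_nat f) -(natr1 n.+1) addrK.
- move=> i j; rewrite dmxE.
  have [->|p0] := eqVneq (P i j) 0; first by rewrite derivC size_poly0.
  by have := lt_size_deriv p0; have := szP i j; lia.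
- move=> i j; rewrite dmxE coef_deriv Pn; case: (i == j); last by rewrite !mulr0n mul0rn.
  by rewrite !mulr1n -mulr_natr; ring.
Qed.
End mirror_symmetry.

(** * Symmetric operators and orthogonality *)

Section orthogonality.
Variables (K : numFieldType) (L : nat).
Local Notation M := 'M[{poly K}]_L.+1.
Local Notation H := (Hmx {poly K} L).
Local Notation F := (Fmx {poly K} L).
Local Notation C := (Cmx {poly K} L).
Implicit Types (P Q X S : M).

Variables (tau kappa : K).
Hypothesis tauE : tau + 1 = kappa + L%:R.
Variables (Lam : {poly K} -> K).
Hypothesis LamD : forall p q, Lam (p + q) = Lam p + Lam q.
Hypothesis LamZ : forall c p, Lam (c *: p) = c * Lam p.
Hypothesis Lam_ibp : forall p, Lam ((1 - 'X^2) * p^`() - kappa *: ('X * p)) = 0.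

Variables (W Y Z : M).
Hypothesis W_sym : W^T = W.
Hypothesis Y_skew : Y^T = - Y.
Hypothesis Z_skew : Z^T = - Z.
Hypothesis HW : ('X *: H + F) * W = (1 - 'X^2) *: Y.
Hypothesis CW : C * W = (1 - 'X^2) *: (dmx W + Z) + (L%:R * 'X) *: W.
Hypothesis Y_ode : 2 *: ((1 - 'X^2) *: dmx Y - (kappa%:P * 'X) *: Y) = tau%:P *: (H * W - W * H).
Hypothesis Z_ode : 4 *: ((1 - 'X^2) *: dmx Z - (kappa%:P * 'X) *: Z) = W * H * H - H * H * W.

Definition Lmx (X : M) : 'M[K]_L.+1 := map_mx Lam X.
Definition weight_form P Q := Lmx (P * W * Q^T).

Definition Eop P : M := 2 *: (dmx P * ('X *: H + F)) + tau%:P *: (P * H).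
Definition Dop P : M := (4 * (1 - 'X^2)) *: dmx (dmx P) + 4 *: (dmx P * C)
  - (4 * (tau%:P + 1) * 'X) *: dmx P - P * H * H.

Let Lam0 : Lam 0 = 0.
Proof. by have := LamZ 0 0; rewrite scale0r mul0r. Qed.
Let LamN p : Lam (- p) = - Lam p.
Proof. by rewrite -scaleN1r LamZ mulN1r. Qed.
Let Lam_sum (I : finType) (G : I -> {poly K}) : Lam (\sum_i G i) = \sum_i Lam (G i).
Proof. by elim/big_rec2: _ => // i y1 y2 _ <-; rewrite LamD. Qed.

Lemma LmxD X1 X2 : Lmx (X1 + X2) = Lmx X1 + Lmx X2.
Proof. by apply/matrixP => i j; rewrite !mxE LamD. Qed.
Lemma LmxB X1 X2 : Lmx (X1 - X2) = Lmx X1 - Lmx X2.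
Proof. by apply/matrixP => i j; rewrite !mxE LamD LamN. Qed.
Lemma Lmx_ibp X : Lmx ((1 - 'X^2) *: dmx X - (kappa%:P * 'X) *: X) = 0.
Proof. by apply/matrixP => i j; rewrite !mxE -mulrA mul_polyC Lam_ibp. Qed.
Lemma LmxZ (c : K) X : Lmx (c%:P *: X) = c *: Lmx X.
Proof. by apply/matrixP => i j; rewrite !mxE mul_polyC LamZ. Qed.

Lemma Lmx_mull (c : 'M[K]_L.+1) X : Lmx (map_mx polyC c * X) = c * Lmx X.
Proof.
apply/matrixP => i j; rewrite !mxE Lam_sum; apply: eq_bigr => k _.
by rewrite !mxE mul_polyC LamZ.
Qed.
Lemma weight_form_tr P Q : (weight_form P Q)^T = weight_form Q P.
Proof.
by rewrite /weight_form /Lmx map_trmx !trmxM trmxK W_sym mulrA.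
Qed.
Lemma weight_formDl P1 P2 Q : weight_form (P1 + P2) Q = weight_form P1 Q + weight_form P2 Q.
Proof. by rewrite /weight_form !mulrDl LmxD. Qed.
Lemma weight_formDr P Q1 Q2 : weight_form P (Q1 + Q2) = weight_form P Q1 + weight_form P Q2.
Proof. by rewrite -weight_form_tr weight_formDl linearD /= !weight_form_tr. Qed.
Lemma weight_form_mull c P Q : weight_form (map_mx polyC c * P) Q = c * weight_form P Q.
Proof. by rewrite /weight_form -!mulrA Lmx_mull !mulrA. Qed.
Lemma weight_form_mulr c P Q : weight_form P (map_mx polyC c * Q) = weight_form P Q * c^T.
Proof. by rewrite -weight_form_tr weight_form_mull trmxM weight_form_tr. Qed.

(** The difference is an integrated total derivative with potential P Y Q^T: by [HW] and the
    skewness of Y the first-order terms are those of the product rule, and [Y_ode] supplies the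
    derivative of Y. *)
Lemma weight_form_Eop P Q : weight_form (Eop P) Q = weight_form P (Eop Q).
Proof.
apply/eqP; rewrite -subr_eq0 /weight_form -LmxB; apply/eqP.
have WH : W * ('X *: H + F^T) = - ((1 - 'X^2) *: Y).
  by have := congr1 trmx HW; rewrite !(trmxD, trmxN, trmxZ, trmxM) W_sym trmx_H Y_skew scalerN => ->.
have -> : Eop P * W * Q^T - P * W * (Eop Q)^T =
   2%:P *: ((1 - 'X^2) *: dmx (P * Y * Q^T) - (kappa%:P * 'X) *: (P * Y * Q^T)).
  rewrite /Eop !(trmxD, trmxN, trmxZ, trmxM) trmx_H !dmxM dmx_tr polyC_natr.
  transitivity (2 *: (dmx P * (('X *: H + F) * W) * Q^T) - 2 *: (P * (W * ('X *: H + F^T)) * (dmx Q)^T)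
     + P * (tau%:P *: (H * W - W * H)) * Q^T).
    by mxring.
  rewrite HW WH -Y_ode.
  by mxring.
by rewrite LmxZ Lmx_ibp scaler0.
Qed.

(** Green's identity with potential [G], in which Z corrects the usual Wronskian. The term L X W of
    [CW] turns [kappa] into [kappa + L], which is why [tauE] fixes [tau]. *)
Lemma weight_form_Dop P Q : weight_form (Dop P) Q = weight_form P (Dop Q).
Proof.
apply/eqP; rewrite -subr_eq0 /weight_form -LmxB; apply/eqP.
have WC : W * C^T = (1 - 'X^2) *: (dmx W - Z) + (L%:R * 'X) *: W.
  by have := congr1 trmx CW; rewrite !(trmxD, trmxN, trmxZ, trmxM) -dmx_tr W_sym Z_skew.
pose G := dmx P * W * Q^T - P * W * (dmx Q)^T + P * Z * Q^T.
have t1 : tau%:P + 1 = kappa%:P + L%:R :> {poly K} by rewrite -polyC1 -polyCD tauE polyCD polyC_natr.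
have -> : Dop P * W * Q^T - P * W * (Dop Q)^T =
   4%:P *: ((1 - 'X^2) *: dmx G - (kappa%:P * 'X) *: G).
  rewrite /Dop /G !(trmxD, trmxN, trmxZ, trmxM) trmx_H !dmxD !dmxN !dmxM !dmx_tr polyC_natr t1.
  transitivity ((4 * (1 - 'X^2)) *: (dmx (dmx P) * W * Q^T)
     - (4 * (1 - 'X^2)) *: (P * W * (dmx (dmx Q))^T)
     + 4 *: (dmx P * (C * W) * Q^T) - 4 *: (P * (W * C^T) * (dmx Q)^T)
     - (4 * (kappa%:P + L%:R) * 'X) *: (dmx P * W * Q^T)
     + (4 * (kappa%:P + L%:R) * 'X) *: (P * W * (dmx Q)^T)
     + P * (W * H * H - H * H * W) * Q^T).
    by mxring.
  rewrite CW WC -Z_ode.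
  by mxring.
by rewrite LmxZ Lmx_ibp scaler0.
Qed.
End orthogonality.

(** * Orthogonal families as eigenfunctions of symmetric operators *)

Section orthogonal_ode.
Variables (K : numFieldType) (L : nat).
Local Notation M := 'M[{poly K}]_L.+1.
Local Notation H := (Hmx {poly K} L).
Local Notation F := (Fmx {poly K} L).
Local Notation C := (Cmx {poly K} L).
Implicit Types (P Q X S : M).

Variables (tau : K) (B : M -> M -> 'M[K]_L.+1).
Hypothesis BDr : forall P Q1 Q2, B P (Q1 + Q2) = B P Q1 + B P Q2.
Hypothesis BDl : forall P1 P2 Q, B (P1 + P2) Q = B P1 Q + B P2 Q.
Hypothesis Bml : forall c P Q, B (map_mx polyC c * P) Q = c * B P Q.
Hypothesis Bmr : forall c P Q, B P (map_mx polyC c * Q) = B P Q * c^T.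
Hypothesis B_E : forall P Q, B (Eop tau P) Q = B P (Eop tau Q).
Hypothesis B_D : forall P Q, B (Dop tau P) Q = B P (Dop tau Q).
Hypothesis B_nondeg : forall P, (forall Q, B P Q = 0) -> P = 0.

Definition mxsize n X := forall i j, (size (X i j) <= n)%N.
Definition monic_family (PP : nat -> M) :=
  forall n, mxsize n.+1 (PP n) /\ forall i j, (PP n i j)`_n = (i == j)%:R.

Lemma mxsize0 X : mxsize 0 X -> X = 0.
Proof. by move=> sX; apply/matrixP => i j; rewrite mxE; apply/eqP; rewrite -size_poly_leq0. Qed.

Lemma mxsize_split PP n S : monic_family PP -> mxsize n.+1 S ->
  exists c S', S = map_mx polyC c * PP n + S' /\ mxsize n S'.
Proof.
move=> /(_ n)[szP leadP] szS.
exists (\matrix_(i, j) (S i j)`_n), (S - map_mx polyC (\matrix_(i, j) (S i j)`_n) * PP n).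
split; first by rewrite addrC subrK.
move=> i j; apply/leq_sizeP => k nk; rewrite !mxE coefB coef_sum.
under eq_bigr do rewrite !mxE coefCM.
have [->|kn] := eqVneq k n.
  under eq_bigr do rewrite leadP.
  rewrite (bigD1 j) //= eqxx mulr1 big1 ?addr0 ?subrr // => l lj.
  by rewrite (negbTE lj) mulr0.
have nk1 : (n < k)%N by rewrite ltn_neqAle eq_sym kn.
rewrite nth_default ?big1 ?subr0 //; last exact: leq_trans (szS i j) nk1.
by move=> l _; rewrite [X in _ * X]nth_default ?mulr0 // (leq_trans (szP l j)).
Qed.

Let B0r P : B P 0 = 0.
Proof. by apply: (addIr (B P 0)); rewrite -BDr addr0 add0r. Qed.
Let B0l P : B 0 P = 0.
Proof. by apply: (addIr (B 0 P)); rewrite -BDl addr0 add0r. Qed.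

Lemma orth_right QQ n X : monic_family QQ -> (forall m, (m < n)%N -> B X (QQ m) = 0) ->
  forall S, mxsize n S -> B X S = 0.
Proof.
move=> monQ; elim: n => [|n IH] oX S szS; first by rewrite (mxsize0 szS).
have [c [S' [-> szS']]] := mxsize_split monQ szS.
by rewrite BDr Bmr oX // mul0r add0r IH // => m mn; apply: oX; apply: ltnW.
Qed.

Lemma orth_left PP n Y : monic_family PP -> (forall m, (m < n)%N -> B (PP m) Y = 0) ->
  forall S, mxsize n S -> B S Y = 0.
Proof.
move=> monP; elim: n => [|n IH] oY S szS; first by rewrite (mxsize0 szS).
have [c [S' [-> szS']]] := mxsize_split monP szS.
by rewrite BDl Bml oY // mulr0 add0r IH // => m mn; apply: oY; apply: ltnW.
Qed.

Lemma mxsize_bound S : exists n, mxsize n S.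
Proof.
exists (\max_i \max_j size (S i j)) => i j.
by apply: leq_trans (leq_bigmax i); exact: leq_bigmax.
Qed.

Lemma orth_eq0 QQ X : monic_family QQ -> (forall m, B X (QQ m) = 0) -> X = 0.
Proof.
move=> monQ oX; apply: B_nondeg => S; have [n szS] := mxsize_bound S.
by apply: (orth_right (n := n) monQ).
Qed.

Let coefXD (p : {poly K}) k : ('X * p^`())`_k = p`_k *+ k.
Proof. by rewrite coefXM; case: k => [|k] //=; rewrite coef_deriv. Qed.

Let coefX2D (p : {poly K}) k : ('X^2 * p^`()^`())`_k = p`_k *+ (k * k.-1).
Proof.
rewrite coefXnM; case: k => [|[|k]] //=; rewrite ?muln0 ?mulr0n //.
by rewrite subSS subSS subn0 !coef_deriv -mulrnA mulnC.
Qed.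

Lemma coef_mulF P i j k : ((P * F) i j)`_k = \sum_l (P i l)`_k * Fmx K L l j.
Proof.
rewrite mxE coef_sum; apply: eq_bigr => l _.
have -> : F l j = (Fmx K L l j)%:P by rewrite !mxE polyCB !polyCMn !polyC1.
by rewrite coefMC.
Qed.

Lemma coef_mulC P i j k : ((P * C) i j)`_k = \sum_l (P i l)`_k * Cmx K L l j.
Proof.
rewrite mxE coef_sum; apply: eq_bigr => l _.
have -> : C l j = (Cmx K L l j)%:P by rewrite !mxE polyCD !polyCMn !polyC1.
by rewrite coefMC.
Qed.

Let h i : K := L%:R - 2 * i%:R.
Let hE i : L%:R - 2 * i%:R = (h i)%:P :> {poly K}.
Proof. by rewrite /h polyCB polyCM !polyC_natr. Qed.

Lemma coef_Eop P i j k : (Eop tau P i j)`_k =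
  2 * ((P i j)`_k *+ k) * h j + 2 * (\sum_l ((P i l)`_k.+1 *+ k.+1) * Fmx K L l j)
  + tau * (P i j)`_k * h j.
Proof.
rewrite /Eop !(addmxE, sclmxE) mulrDr addmxE mulmx_H.
rewrite -scalerAr sclmxE mulmx_H !hE dmxE.
rewrite -(polyC_natr _ 2) !coefD !coefCM !coefD mulrDr coef_mulF mulrA coefMC.
rewrite coefMC coefXD mulrA; congr (_ + _ + _); last by rewrite mulrA.
by congr (_ * _); apply: eq_bigr => l _; rewrite dmxE coef_deriv.
Qed.

Lemma coef_Dop P i j k : (Dop tau P i j)`_k =
  4 * ((P i j)`_k.+2 *+ (k.+2 * k.+1) - (P i j)`_k *+ (k * k.-1))
  + 4 * (\sum_l ((P i l)`_k.+1 *+ k.+1) * Cmx K L l j) - 4 * (tau + 1) * ((P i j)`_k *+ k)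
  - (P i j)`_k * h j * h j.
Proof.
rewrite /Dop !(addmxE, oppmxE, sclmxE) !mulmx_H !hE !dmxE.
rewrite (_ : 4 * (1 - 'X^2) * (P i j)^`()^`() =
    4%:P * ((P i j)^`()^`() - 'X^2 * (P i j)^`()^`())); last first.
  by rewrite (polyC_natr _ 4); ring.
rewrite (_ : 4 * (tau%:P + 1) * 'X * (P i j)^`() =
    (4 * (tau + 1))%:P * ('X * (P i j)^`())); last by ring.
rewrite -(polyC_natr _ 4) !coefB !coefD !coefCM coefB coefX2D coefXD coef_mulC !coefMC !coef_deriv.
rewrite -mulrnA mulnC; congr (_ + _ - _ - _).
by congr (_ * _); apply: eq_bigr => l _; rewrite dmxE coef_deriv.
Qed.

Lemma mxsize_Eop n P : mxsize n P -> mxsize n (Eop tau P).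
Proof.
move=> szP i j; apply/leq_sizeP => k nk; rewrite coef_Eop.
have P0 l k' : (k <= k')%N -> (P i l)`_k' = 0.
  by move=> kk; rewrite nth_default // (leq_trans (szP i l)) // (leq_trans nk).
rewrite P0 // big1 ?mul0rn ?mulr0 ?mul0r ?addr0 // => l _.
by rewrite P0 ?mul0rn ?mul0r.
Qed.

Lemma mxsize_Dop n P : mxsize n P -> mxsize n (Dop tau P).
Proof.
move=> szP i j; apply/leq_sizeP => k nk; rewrite coef_Dop.
have P0 l k' : (k <= k')%N -> (P i l)`_k' = 0.
  by move=> kk; rewrite nth_default // (leq_trans (szP i l)) // (leq_trans nk).
rewrite !P0 ?leqW // big1 ?mul0rn ?mulr0 ?mul0r ?subr0 ?mulr0 ?addr0 // => l _.
by rewrite P0 ?mul0rn ?mul0r.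
Qed.

Variables (PP QQ : nat -> M).
Hypotheses (monP : monic_family PP) (monQ : monic_family QQ).
Hypothesis orth : forall n m, n <> m -> B (PP n) (QQ m) = 0.

Let orthr n S : mxsize n S -> B (PP n) S = 0.
Proof.
by move=> szS; apply: (orth_right monQ _ szS) => m mn; apply: orth => E; rewrite E ltnn in mn.
Qed.

Let orthl n S : mxsize n S -> B S (QQ n) = 0.
Proof.
by move=> szS; apply: (orth_left monP _ szS) => m mn; apply: orth => E; rewrite E ltnn in mn.
Qed.

(** Orthogonality to [QQ m] holds for [m >= n] by the size hypothesis, and for [m < n] by moving [T]
    to the other side, where it does not raise the degree. *)
Let orth_shift n (T : M -> M) (c : 'M[K]_L.+1) :
  (forall P Q, B (T P) Q = B P (T Q)) -> (forall k P, mxsize k P -> mxsize k (T P)) ->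
  mxsize n (T (PP n) + map_mx polyC c * PP n) -> T (PP n) + map_mx polyC c * PP n = 0.
Proof.
move=> BT szT szX; apply: (orth_eq0 monQ) => m.
have [mn|nm] := ltnP m n; last first.
  by apply: orthl => i j; exact: leq_trans (szX i j) nm.
rewrite BDl Bml BT !orthr ?mulr0 ?addr0 //.
  by case: (monQ m) => sz _ i j; exact: leq_trans (sz i j) mn.
by apply: szT; case: (monQ m) => sz _ i j; exact: leq_trans (sz i j) mn.
Qed.

Lemma orth_opE n : opE tau%:P n%:R%:P (PP n) = 0.
Proof.
have [szP leadP] := monP n.
(* [- c] is the coefficient of X^n in [Eop tau (PP n)], as [PP n] has leading coefficient 1; the
   matrix in [orth_opD] is found likewise. *)
pose c : 'M[K]_L.+1 := - ((tau + 2 * n%:R) *: Hmx K L).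
have EE : opE tau%:P n%:R%:P (PP n) = Eop tau (PP n) + map_mx polyC c * PP n.
  rewrite /opE /Eop; congr (_ + _).
  have -> : map_mx polyC c = - ((tau%:P + 2 * n%:R%:P) *: H).
    by apply/matrixP => i j; rewrite !mxE; case: (i == j); rewrite ?mulr1n ?mulr0n; ring.
  by rewrite mulNr -scalerAl.
rewrite EE; apply: orth_shift => //; first exact: mxsize_Eop.
move=> i j; apply/leq_sizeP => k nk; rewrite addmxE coefD coef_Eop.
have -> : (map_mx polyC c * PP n) i j = (- (tau + 2 * n%:R) * h i)%:P * PP n i j.
  rewrite mxE (bigD1 i) //= big1 ?addr0 => [|l li]; first by rewrite !mxE eqxx mulr1n /h mulNr.
  by rewrite !mxE eq_sym (negbTE li) mulr0n mulr0 oppr0 polyC0 mul0r.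
have P0 l k' : (n < k')%N -> (PP n i l)`_k' = 0.
  by move=> kk; rewrite nth_default // (leq_trans (szP i l)).
rewrite coefCM big1 => [|l _]; last by rewrite P0 // mul0rn mul0r.
have [->|kn] := eqVneq k n; last first.
  by rewrite P0 ?mul0rn ?mulr0 ?mul0r ?addr0 // ltn_neqAle eq_sym kn.
rewrite leadP; have [->|ij] := eqVneq i j; last by rewrite !(mulr0, mul0rn, mul0r, addr0).
by rewrite -mulr_natr; ring.
Qed.

Let mul_HHD (p : {poly K}) X : (H * H + p *: 1) * X = H * H * X + p *: X.
Proof. by rewrite mulrDl -scalerAl mul1r. Qed.

Lemma orth_opD n : opD tau%:P n%:R%:P (PP n) = 0.
Proof.
have [szP leadP] := monP n.
pose c : 'M[K]_L.+1 := Hmx K L * Hmx K L + (4 * n%:R * (n%:R + tau)) *: 1.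
have cE : map_mx polyC c = H * H + (4 * n%:R * (n%:R + tau%:P)) *: 1.
  apply/matrixP => i j; rewrite !mxE polyCD; congr (_ + _).
    rewrite rmorph_sum; apply: eq_bigr => l _.
    by rewrite !mxE; case: (i == l); case: (l == j); rewrite ?mulr1n ?mulr0n; ring.
  by case: (i == j); rewrite ?mulr1n ?mulr0n; ring.
have EE : opD tau%:P n%:R%:P (PP n) = Dop tau (PP n) + map_mx polyC c * PP n.
  rewrite /opD /Dop cE mul_HHD polyC_natr opprB.
  by apply/matrixP => i j; rewrite !(addmxE, oppmxE, sclmxE); ring.
rewrite EE; apply: orth_shift => //; first exact: mxsize_Dop.
move=> i j; apply/leq_sizeP => k nk; rewrite addmxE coefD coef_Dop.
have -> : (map_mx polyC c * PP n) i j = (h i * h i + 4 * n%:R * (n%:R + tau))%:P * PP n i j.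
  rewrite cE mul_HHD addmxE sclmxE -mulrA !mul_Hmx !hE.
  ring.
have P0 l k' : (n < k')%N -> (PP n i l)`_k' = 0.
  by move=> kk; rewrite nth_default // (leq_trans (szP i l)).
rewrite coefCM (P0 j k.+2); last by rewrite ltnW.
rewrite big1; last by move=> l _; rewrite P0 // mul0rn mul0r.
have [->|kn] := eqVneq k n; last first.
  rewrite P0; last by rewrite ltn_neqAle eq_sym kn.
  by rewrite !(mul0rn, mulr0, mul0r, subr0, addr0).
rewrite leadP; have [->|ij] := eqVneq i j; last by rewrite !(mulr0, mul0rn, mul0r, addr0, subr0).
by case: n {szP leadP nk P0 c cE EE} => [|n] /=; ring.
Qed.
End orthogonal_ode.

Local Open Scope complex_scope.

(** * The matrix weight *)

Section complex_functional.
Variables (R : realType) (nu : R) (nu_gt0 : 0 < nu).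
Local Notation K := R[i].
Local Notation pC := (map_poly (real_complex R)).
Implicit Types (p q : {poly K}) (u v : {poly R}).

Let mkC (a b : R) : a%:C + 'i * b%:C = a +i* b.
Proof. by rewrite [RHS]complexE. Qed.

Definition pRe p : {poly R} := map_poly (@complex.Re R) p.
Definition pIm p : {poly R} := map_poly (@complex.Im R) p.

Lemma pReIm p : p = pC (pRe p) + 'i *: pC (pIm p).
Proof.
apply/polyP => k; rewrite coefD coefZ !coef_map_id0 ?rmorph0 //=.
exact: complexE.
Qed.

Lemma pRe_mk u v : pRe (pC u + 'i *: pC v) = u.
Proof.
apply/polyP => k; rewrite coef_map_id0 // coefD coefZ !coef_map_id0 ?rmorph0 //.
by rewrite mkC.
Qed.

Lemma pIm_mk u v : pIm (pC u + 'i *: pC v) = v.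
Proof.
apply/polyP => k; rewrite coef_map_id0 // coefD coefZ !coef_map_id0 ?rmorph0 //.
by rewrite mkC.
Qed.

(** The complex linear extension of [ultra_int nu]; the variable of integration stays real. *)
Definition ultraC p : K := ultra_int nu (pRe p) +i* ultra_int nu (pIm p).

Lemma ultraC_mk u v : ultraC (pC u + 'i *: pC v) = ultra_int nu u +i* ultra_int nu v.
Proof. by rewrite /ultraC pRe_mk pIm_mk. Qed.

Let split (P : {poly K} -> Prop) : (forall u v, P (pC u + 'i *: pC v)) -> forall p, P p.
Proof. by move=> H p; rewrite (pReIm p). Qed.

Lemma ultraCD p q : ultraC (p + q) = ultraC p + ultraC q.
Proof.
move: p q; apply: split => u v; apply: split => u' v'.
have -> : pC u + 'i *: pC v + (pC u' + 'i *: pC v') = pC (u + u') + 'i *: pC (v + v').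
  by rewrite !rmorphD /= scalerDr addrACA.
by rewrite !ultraC_mk !ultra_intD.
Qed.

Lemma ultraCZ c p : ultraC (c *: p) = c * ultraC p.
Proof.
move: p; apply: split => u v; case: c => a b.
have -> : (a +i* b) *: (pC u + 'i *: pC v) = pC (a *: u - b *: v) + 'i *: pC (a *: v + b *: u).
  apply/polyP => k; rewrite !(coefZ, coefD, coef_map, coefN) !mkC.
  by apply/eqP; rewrite eq_complex; apply/andP; split; apply/eqP; rewrite /=; ring.
rewrite !ultraC_mk !ultra_intD // -scaleNr !ultra_intZ //.
by apply/eqP; rewrite eq_complex; apply/andP; split; apply/eqP; rewrite /=; ring.
Qed.

Lemma ultraC_ibp p : ultraC ((1 - 'X^2) * p^`() - (2 * nu + 1)%:C *: ('X * p)) = 0.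
Proof.
move: p; apply: split => u v.
have -> : (1 - 'X^2) * (pC u + 'i *: pC v)^`() - (2 * nu + 1)%:C *: ('X * (pC u + 'i *: pC v)) =
   pC ((1 - 'X^2) * u^`() - (2 * nu + 1) *: ('X * u))
   + 'i *: pC ((1 - 'X^2) * v^`() - (2 * nu + 1) *: ('X * v)).
  rewrite derivD derivZ !deriv_map !rmorphB /= !map_polyZ /=.
  rewrite !rmorphM /= !rmorphB /= !map_polyX !map_polyXn !rmorph1 -!mul_polyC.
  by ring.
by rewrite ultraC_mk !ultra_int_ibp.
Qed.

Lemma ultraC_nondeg p : (forall q, ultraC (p * q) = 0) -> p = 0.
Proof.
move: p; apply: split => u v H.
have mk w : (pC u + 'i *: pC v) * pC w = pC (u * w) + 'i *: pC (v * w).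
  by rewrite !rmorphM /= mulrDl scalerAl.
have u0 : u = 0.
  apply: contrapT => /eqP u0; have := ultra_int_sq_gt0 nu_gt0 u0.
  by have := H (pC u); rewrite mk ultraC_mk => -[-> _]; rewrite ltxx.
have v0 : v = 0.
  apply: contrapT => /eqP v0; have := ultra_int_sq_gt0 nu_gt0 v0.
  by have := H (pC v); rewrite mk ultraC_mk => -[_ ->]; rewrite ltxx.
by rewrite u0 v0 rmorph0 scaler0 addr0.
Qed.
End complex_functional.

(** * The inner product in terms of matrices of polynomials *)

Section bridge.
Variables (R : realType) (L : nat) (nu : R) (nu_gt0 : 0 < nu).
Local Notation K := R[i].
Local Notation pC := (map_poly (real_complex R)).
Local Notation M := 'M[{poly K}]_L.+1.
Implicit Types (p q : {poly 'M[K]_L.+1}).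

Definition pmx p : M := \matrix_(i, j) map_poly (fun X : 'M[K]_L.+1 => X i j) p.
(** At real points the adjoint of a matrix polynomial is the transpose of the one with conjugated
    coefficients, so the sesquilinear inner product becomes the bilinear [weight_form]. *)
Definition pmx_conj p : M := map_mx (map_poly Num.conj) (pmx p).
Definition weight_mx : M := \matrix_(i, j) pC (weight_poly L nu i j).

Lemma coef_pmx p i j k : (pmx p i j)`_k = p`_k i j.
Proof. by rewrite mxE coef_map_id0 ?mxE. Qed.

Lemma mxeval_entry p x i j : mxeval p x i j = (pmx p i j).[x].
Proof.
rewrite /mxeval horner_coef summxE (@horner_coef_wide _ (size p)); last by rewrite mxE size_poly.
apply: eq_bigr => k _; rewrite coef_pmx.
have -> : (x%:M : 'M[K]_L.+1) ^+ k = (x ^+ k)%:M by rewrite -rmorphXn.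
by rewrite -[_ * _]/(_ *m _) mul_mx_scalar mxE mulrC.
Qed.

Lemma size_pmx p i j : (size (pmx p i j) <= size p)%N.
Proof. by rewrite mxE size_poly. Qed.

Lemma conj_mxeval_entry p (x : R) i j :
  Num.conj (mxeval p x%:C i j) = (pmx_conj p i j).[x%:C].
Proof.
rewrite mxeval_entry -horner_map [in RHS]mxE /=; congr (_.[_]).
exact: conjc_real.
Qed.

Lemma ultraC_int (g : R -> K) (G : {poly K}) :
  (forall x, g x = ((1 - x ^+ 2) `^ (nu - 2^-1))%:C * G.[x%:C]) ->
  (\int[@lebesgue_measure R]_(x in `]-1, 1[) complex.Re (g x))
     +i* (\int[@lebesgue_measure R]_(x in `]-1, 1[) complex.Im (g x)) = ultraC nu G.
Proof.
move=> gE; rewrite /ultraC /ultra_int.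
have GE x : G.[x%:C] = (pRe G).[x] +i* (pIm G).[x].
  rewrite {1}(pReIm G) hornerD hornerZ !horner_map /=.
  by rewrite [RHS]complexE.
by congr (_ +i* _); apply: eq_Rintegral => x _; rewrite gE GE /=; ring.
Qed.

Lemma mxinnerE p q : mxinner nu p q = weight_form (ultraC nu) weight_mx (pmx p) (pmx_conj q).
Proof.
apply/matrixP => i j; rewrite mxE [RHS]mxE; apply: ultraC_int => x.
rewrite !mxE horner_sum mulr_sumr; apply: eq_bigr => l _.
rewrite !mxE hornerM mulrA; congr (_ * _); last by rewrite conj_mxeval_entry !mxE.
rewrite horner_sum mulr_sumr; apply: eq_bigr => k _.
rewrite mxeval_entry hornerM mulrCA; congr (_ * _).
by rewrite [LHS]mxE weight_polyE // [weight_mx _ _]mxE horner_map rmorphM.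
Qed.
End bridge.

(** * Relations between the weight and the sl2 matrices *)

Section weight_matrix.
Variables (R : realType) (L : nat) (nu : R) (nu_gt0 : 0 < nu).
Local Notation K := R[i].
Local Notation pC := (map_poly (real_complex R)).
Local Notation M := 'M[{poly K}]_L.+1.
Local Notation H := (Hmx {poly K} L).
Local Notation F := (Fmx {poly K} L).
Local Notation C := (Cmx {poly K} L).
Local Notation W := (weight_mx L nu).
Local Notation w := (weight_poly L nu).
Local Notation D := (weight_prim L nu).
Local Notation tau := (L%:R + 2 * nu).

(** Row [i] of a tridiagonal matrix with zero diagonal. At the ends [i.-1] or [i.+1] is not a
    genuine neighbour, and the hypotheses make its coefficient 0. *)
Lemma sum_adjacent (A : comNzRingType) (i : 'I_L.+1) (a b : A) (g : nat -> A) :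
  (nat_of_ord i = 0%N -> a = 0) -> (nat_of_ord i = L -> b = 0) ->
  \sum_(k < L.+1) (a *+ (k.+1 == i) + b *+ (k == i.+1 :> nat)) * g k = a * g i.-1 + b * g i.+1.
Proof.
move=> a0 b0; under eq_bigr do rewrite mulrDl !mulrnAl.
rewrite big_split /=; congr (_ + _).
  case: (posnP i) => [i0|ipos].
    rewrite (a0 i0) mul0r big1 // => k _; by rewrite mul0r mul0rn.
  have ilt : (i.-1 < L.+1)%N by have := ltn_ord i; lia.
  rewrite (bigD1 (Ordinal ilt)) //= prednK // eqxx mulr1n big1 ?addr0 // => k /eqP ki.
  rewrite (_ : (k.+1 == i) = false) ?mulr0n //; apply/eqP => E; apply: ki; apply: val_inj => /=; lia.
have [iL|iL] := eqVneq (i : nat) L.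
  rewrite (b0 iL) mul0r big1 // => k _; by rewrite mul0r mul0rn.
have ilt : (i.+1 < L.+1)%N by have := ltn_ord i; lia.
rewrite (bigD1 (Ordinal ilt)) //= eqxx mulr1n big1 ?addr0 // => k /eqP ki.
by rewrite (_ : (k == i.+1 :> nat) = false) ?mulr0n //; apply/eqP => E; apply: ki; apply: val_inj.
Qed.

(** Half the difference of the two row relations: the derivative cancels, and the constants combine
    to (i - j)(i + j + 2 nu) - (j - i)(2L - i - j + 2 nu) = 2 tau (i - j). Half the sum gives
    [weight_poly_C]. *)
Lemma weight_poly_F (i j : 'I_L.+1) :
  i%:R * w i.-1 j - (L - i)%:R * w i.+1 j =
  - ((L%:R - 2 * i%:R) * 'X * w i j) + (1 - 'X^2) * ((tau * (i%:R - j%:R)) *: D i j).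
Proof.
have iL : (i <= L)%N by rewrite -ltnS.
have jL : (j <= L)%N by rewrite -ltnS.
have n2 : (2 : {poly R}) != 0 by rewrite -(polyC_natr _ 2) polyC_eq0 pnatr_eq0.
apply: (mulfI n2); have := weight_poly_down nu_gt0 iL jL; have := weight_poly_up nu_gt0 iL jL.
rewrite -!mul_polyC => hu hd.
transitivity ((2 * i%:R)%:P * w i.-1 j - (2 * (L - i)%:R)%:P * w i.+1 j).
  by rewrite !polyCM !polyC_natr; ring.
rewrite hu hd !natrB // !(polyCM, polyCD, polyCN, polyC_natr).
ring.
Qed.

Lemma weight_poly_C (i j : 'I_L.+1) :
  i%:R * w i.-1 j + (L - i)%:R * w i.+1 j =
  (1 - 'X^2) * ((w i j)^`() + ((j%:R - i%:R) * (L%:R - i%:R - j%:R)) *: D i j) + L%:R * 'X * w i j.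
Proof.
have iL : (i <= L)%N by rewrite -ltnS.
have jL : (j <= L)%N by rewrite -ltnS.
have n2 : (2 : {poly R}) != 0 by rewrite -(polyC_natr _ 2) polyC_eq0 pnatr_eq0.
apply: (mulfI n2); have := weight_poly_down nu_gt0 iL jL; have := weight_poly_up nu_gt0 iL jL.
rewrite -!mul_polyC => hu hd.
transitivity ((2 * i%:R)%:P * w i.-1 j + (2 * (L - i)%:R)%:P * w i.+1 j).
  by rewrite !polyCM !polyC_natr; ring.
rewrite hu hd !natrB // !(polyCM, polyCD, polyCN, polyC_natr).
ring.
Qed.

(** In terms of the eigenvalues h_i = L - 2i of H, the factors here and in [weight_Z] are -tau (h_i
    - h_j)/2 and (h_i^2 - h_j^2)/4, hence the commutators with H and H^2. *)
Definition weight_Y : M := \matrix_(i, j) pC ((tau * (i%:R - j%:R)) *: D i j).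
Definition weight_Z : M := \matrix_(i, j) pC (((j%:R - i%:R) * (L%:R - i%:R - j%:R)) *: D i j).

Lemma weight_mx_sym : W^T = W.
Proof. by apply/matrixP => i j; rewrite !mxE weight_polyC. Qed.

Lemma weight_Y_skew : weight_Y^T = - weight_Y.
Proof.
apply/matrixP => i j; rewrite !mxE weight_primC -rmorphN -scaleNr; congr (pC (_ *: _)).
ring.
Qed.

Lemma weight_Z_skew : weight_Z^T = - weight_Z.
Proof.
apply/matrixP => i j; rewrite !mxE weight_primC -rmorphN -scaleNr; congr (pC (_ *: _)).
ring.
Qed.

Let pCX : pC 'X = 'X. Proof. exact: map_polyX. Qed.
Let pCX2 : pC 'X^2 = 'X^2. Proof. exact: map_polyXn. Qed.

Let pCD (u v : {poly R}) : pC (u + v) = pC u + pC v. Proof. exact: rmorphD. Qed.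
Let pCN (u : {poly R}) : pC (- u) = - pC u. Proof. exact: rmorphN. Qed.
Let pCM (u v : {poly R}) : pC (u * v) = pC u * pC v. Proof. exact: rmorphM. Qed.
Let pC1 : pC 1 = 1. Proof. exact: rmorph1. Qed.
Let pCn n : pC n%:R = n%:R. Proof. exact: rmorph_nat. Qed.
Let pCE := (pCD, pCN, pCM, pC1, pCn, pCX, pCX2).

Lemma weight_mx_H : ('X *: H + F) * W = (1 - 'X^2) *: weight_Y.
Proof.
apply/matrixP => i j; rewrite mulrDl addmxE -scalerAl sclmxE mul_Hmx sclmxE [weight_Y i j]mxE.
have -> : (F * W) i j = pC (i%:R * w i.-1 j - (L - i)%:R * w i.+1 j).
  rewrite mxE !pCE -mulNr.
  rewrite -(@sum_adjacent _ i i%:R (- (L - i)%:R) (fun k => pC (w k j))).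
  - by apply: eq_bigr => k _; rewrite !mxE mulNrn.
  - by move=> ->.
  - by move=> ->; rewrite subnn oppr0.
rewrite weight_poly_F [W i j]mxE !pCE.
ring.
Qed.

Lemma weight_mx_C : C * W = (1 - 'X^2) *: (dmx W + weight_Z) + (L%:R * 'X) *: W.
Proof.
apply/matrixP => i j; rewrite !(addmxE, sclmxE) dmxE [weight_Z i j]mxE [W i j]mxE.
have -> : (C * W) i j = pC (i%:R * w i.-1 j + (L - i)%:R * w i.+1 j).
  rewrite mxE !pCE.
  rewrite -(@sum_adjacent _ i i%:R ((L - i)%:R) (fun k => pC (w k j))).
  - by apply: eq_bigr => k _; rewrite !mxE.
  - by move=> ->.
  - by move=> ->; rewrite subnn.
rewrite weight_poly_C !pCE deriv_map.
ring.
Qed.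

Let ode i j : i != j -> (1 - 'X^2) * pC (D i j)^`() - (2 * nu + 1)%:C%:P * 'X * pC (D i j) = - pC (w i j).
Proof.
move=> ij; rewrite -pCN -(weight_prim_ode L nu_gt0 ij) !pCE map_polyZ /= ?pCE.
by rewrite -mul_polyC mulrA.
Qed.

Lemma weight_Y_ode : 2 *: ((1 - 'X^2) *: dmx weight_Y - ((2 * nu + 1)%:C%:P * 'X) *: weight_Y)
  = (tau%:C)%:P *: (H * W - W * H).
Proof.
apply/matrixP => i j; rewrite !(addmxE, oppmxE, sclmxE) mul_Hmx mulmx_H dmxE.
rewrite [weight_Y i j]mxE [W i j]mxE.
rewrite map_polyZ /= derivZ deriv_map /= -!mul_polyC.
have [ij|ij] := eqVneq (i : nat) j.
  rewrite ij subrr mulr0 !rmorph0 ?polyC0; ring.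
transitivity (2 * ((tau * (i%:R - j%:R))%:C)%:P *
   ((1 - 'X^2) * pC (D i j)^`() - (2 * nu + 1)%:C%:P * 'X * pC (D i j))); first by ring.
rewrite ode //; ring.
Qed.

Lemma weight_Z_ode : 4 *: ((1 - 'X^2) *: dmx weight_Z - ((2 * nu + 1)%:C%:P * 'X) *: weight_Z)
  = W * H * H - H * H * W.
Proof.
apply/matrixP => i j; rewrite !(addmxE, oppmxE, sclmxE) -(mulrA H H) !mul_Hmx !mulmx_H dmxE.
rewrite [weight_Z i j]mxE [W i j]mxE.
rewrite map_polyZ /= derivZ deriv_map /= -!mul_polyC.
have [ij|ij] := eqVneq (i : nat) j.
  rewrite ij subrr mul0r !rmorph0 ?polyC0; ring.
transitivity (4 * (((j%:R - i%:R) * (L%:R - i%:R - j%:R))%:C)%:P *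
   ((1 - 'X^2) * pC (D i j)^`() - (2 * nu + 1)%:C%:P * 'X * pC (D i j))); first by ring.
rewrite ode //; ring.
Qed.
End weight_matrix.

(** * Nondegeneracy of the matrix form *)

Section nondegeneracy.
Variables (R : realType) (L : nat) (nu : R) (nu_gt0 : 0 < nu).
Local Notation K := R[i].
Local Notation M := 'M[{poly K}]_L.+1.
Local Notation W := (weight_mx L nu).
Local Notation w := (weight_poly L nu).

(** Since k >= i + j - L, the degree i + j - 2k is at most L - k. It equals L only for k = 0 and i +
    j = L, which also underlies the next two lemmas. *)
Lemma size_weight_poly (i j : 'I_L.+1) : (size (w i j) <= L.+1)%N.
Proof.
apply: (leq_trans (size_sum _ _ _)); apply/bigmax_leqP => k _.
have [H|/wcoef_eq0 ->] := boolP [&& i + j - L <= k, k <= minn i j, i <= L & j <= L]%N; last first.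
  by rewrite scale0r size_poly0.
by apply: (leq_trans (size_scale_leq _ _)); rewrite size_gegenbauer // ltnS; lia.
Qed.

Lemma coef_weight_poly_off (i j : 'I_L.+1) : (i + j != L)%N -> (w i j)`_L = 0.
Proof.
move=> ijL; rewrite coef_sum big1 // => k _.
have [H|/wcoef_eq0 ->] := boolP [&& i + j - L <= k, k <= minn i j, i <= L & j <= L]%N; last first.
  by rewrite scale0r coef0.
rewrite coefZ [X in _ * X]nth_default ?mulr0 // size_gegenbauer //; move/eqP : ijL => ijL; lia.
Qed.

Lemma coef_weight_poly_anti (i j : 'I_L.+1) : (i + j = L)%N -> (w i j)`_L != 0.
Proof.
move=> ijL; rewrite coef_sum big_ord_recl big1 ?addr0 => [|k _]; last first.
  by rewrite coefZ [X in _ * X]nth_default ?mulr0 // size_gegenbauer // lift0 ijL; have := ltn_ord k; lia.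
rewrite /= subn0 ijL coefZ mulf_neq0 //.
  have LE : L = (0 + i + j + 0)%N by rewrite addn0.
  rewrite -[nat_of_ord i]add0n -[nat_of_ord j]add0n (wcoefE nu_gt0 LE) /wc.
  have f0 n : (n`!%:R : R) != 0 by rewrite pnatr_eq0 -lt0n fact_gt0.
  have p0 a n : 0 < a -> pochhammer a n != 0 by move=> a0; rewrite gt_eqF // pochhammer_gt0.
  have d0 n : n%:R + nu != 0 by rewrite gt_eqF // ltr_wpDl.
  rewrite expr0 mul1r pochhammer0 mulr1.
  by rewrite !mulf_neq0 ?invr_eq0 ?mulf_neq0 ?f0 ?p0 ?d0 // mulr_gt0.
have : lead_coef (gegenbauer nu L) != 0.
  by rewrite lead_coef_eq0 -size_poly_eq0 size_gegenbauer.
by rewrite lead_coefE size_gegenbauer.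
Qed.

Lemma coef_prod_top (A : comNzRingType) (p q : {poly A}) n m :
  (size p <= n.+1)%N -> (size q <= m.+1)%N -> (p * q)`_(n + m) = p`_n * q`_m.
Proof.
move=> sp sq; rewrite coefM (bigD1 (inord n)) //= inordK ?ltnS ?leq_addr //.
rewrite addKn big1 ?addr0 // => k kn.
have {}kn : (k : nat) != n.
  by apply: contraNneq kn => E; apply/eqP/val_inj; rewrite /= inordK ?ltnS ?leq_addr.
have := ltn_ord k; case: (ltngtP k n) kn => // kn _ klt.
  by rewrite [X in _ * X]nth_default ?mulr0 //; apply: (leq_trans sq); lia.
by rewrite nth_default ?mul0r //; apply: (leq_trans sp); lia.
Qed.

Lemma weight_mxE i j : W i j = map_poly (real_complex R) (w i j).
Proof. by rewrite mxE. Qed.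

(** The coefficient of X^L in W is antidiagonal with nonzero entries, hence invertible, so the top
    coefficient of P must vanish. *)
Lemma mul_weight_mx_eq0 (P : M) : P * W = 0 -> P = 0.
Proof.
move=> PW; have [n] := mxsize_bound P.
elim: n => [|n IH] szP; first exact: mxsize0.
apply: IH => i j; apply/leq_sizeP => k nk.
have [->|kn] := eqVneq k n; last first.
  by rewrite nth_default // (leq_trans (szP i j)) // ltn_neqAle eq_sym kn.
have := congr1 (fun X : M => (X i (rev_ord j))`_(n + L)) PW.
rewrite [in RHS]mxE coef0 mxE coef_sum (bigD1 j) //= big1 => [|l lj].
  rewrite addr0 weight_mxE coef_prod_top ?szP //; last by rewrite size_map_poly size_weight_poly.
  have anti : (w j (rev_ord j))`_L != 0.
    by apply: coef_weight_poly_anti; rewrite /=; have := ltn_ord j; lia.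
  by rewrite coef_map /= => /eqP; rewrite mulf_eq0 fmorph_eq0 (negbTE anti) orbF => /eqP.
rewrite weight_mxE coef_prod_top ?szP //; last by rewrite size_map_poly size_weight_poly.
have off : (w l (rev_ord j))`_L = 0.
  apply: coef_weight_poly_off; apply: contraNneq lj => E; apply/eqP/val_inj.
  by move: E => /=; have := ltn_ord j; lia.
have z : real_complex R 0 = 0 by exact: rmorph0.
by rewrite coef_map off [X in _ * X]z mulr0.
Qed.

Lemma weight_form_nondeg (P : M) : (forall Q, weight_form (ultraC nu) W P Q = 0) -> P = 0.
Proof.
move=> H; apply: mul_weight_mx_eq0; apply/matrixP => i j; rewrite [RHS]mxE.
apply: (ultraC_nondeg nu_gt0) => q.
have := congr1 (fun X : 'M[K]_L.+1 => X i j) (H (q *: 1)).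
rewrite /weight_form /Lmx mxE [RHS]mxE => <-; congr (ultraC nu _).
have -> : (q *: (1 : M))^T = q *: 1 by apply/matrixP => a b; rewrite !mxE eq_sym.
by rewrite -scalerAr mulr1 [RHS]mxE mulrC.
Qed.
End nondegeneracy.

(** * The normalizing coefficients *)

Section normalization.
Variables (R : realType) (L : nat).
Local Notation K := R[i].

Lemma pochhammerSl (a : R) k : pochhammer a k.+1 = a * pochhammer (a + 1) k.
Proof.
rewrite /pochhammer big_ord_recl addr0; congr (_ * _); apply: eq_bigr => i _.
by rewrite /bump /= natrD addrA.
Qed.

Definition Dcoef (s : R) (i : nat) : R :=
  'C(L, i)%:R * (pochhammer s i / pochhammer (s + (L - i)%:R) i).

Lemma Dcoef_neq0 (s : R) i : 0 < s -> (i <= L)%N -> Dcoef s i != 0.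
Proof.
move=> s0 iL; rewrite /Dcoef !mulf_neq0 ?invr_eq0 ?pnatr_eq0 -?lt0n ?bin_gt0 //.
  by rewrite gt_eqF // pochhammer_gt0.
by rewrite gt_eqF // pochhammer_gt0 // ltr_wpDr.
Qed.

Lemma Dcoef_step (s : R) i : 0 < s -> (i < L)%N ->
  Dcoef s i * ((L - i)%:R * (s + i%:R)) = Dcoef s i.+1 * (i.+1%:R * (s + (L - i.+1)%:R)).
Proof.
move=> s0 iL; rewrite /Dcoef.
have -> : pochhammer (s + (L - i.+1)%:R) i.+1 = (s + (L - i.+1)%:R) * pochhammer (s + (L - i)%:R) i.
  by rewrite pochhammerSl -addrA natr1; congr (_ * pochhammer (_ + _%:R) _); lia.
rewrite pochhammerS.
have b : 'C(L, i.+1)%:R * i.+1%:R = 'C(L, i)%:R * (L - i)%:R :> R.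
  by rewrite -!natrM mulnC mul_bin_left mulnC.
have p1 : pochhammer (s + (L - i)%:R) i != 0 by rewrite gt_eqF // pochhammer_gt0 // ltr_wpDr.
have p2 : s + (L - i.+1)%:R != 0 by rewrite gt_eqF // ltr_wpDr.
transitivity (('C(L, i)%:R * (L - i)%:R) * (pochhammer s i * (s + i%:R)) / pochhammer (s + (L - i)%:R) i).
  by field; rewrite p1.
rewrite -b; by field; rewrite p1 p2.
Qed.

(** Only adjacent indices matter, as F is tridiagonal with zero diagonal. For j = i + 1 the two
    scalar factors are 4(s + i) and -4(s + L - i - 1), so the condition is the recurrence
    [Dcoef_step], which determines the coefficients up to a common scalar. *)
Lemma Dcoef_F (s : R) (i j : 'I_L.+1) : 0 < s ->
  let mu := L%:R + 2 * s in
  let h (k : 'I_L.+1) : R := L%:R - 2 * k%:R in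
  (Dcoef s i)%:C * (Fmx K L i j * ((mu - 2) * h i - mu * h j)%:C) =
  (Dcoef s j)%:C * (Fmx K L j i * ((mu - 2) * h j - mu * h i)%:C).
Proof.
move=> s0 mu h.
have FR a b : Fmx K L a b = (Fmx R L a b)%:C.
  by rewrite !mxE rmorphB !rmorphMn rmorph1.
rewrite !FR -!rmorphM /=; congr (_%:C).
wlog ij : i j / (i <= j)%N => [hw|].
  by case: (leqP i j) => [/hw//|/ltnW/hw ->].
rewrite !mxE.
have [E|E] := eqVneq (j : nat) i.+1; last first.
  rewrite (_ : (j.+1 == i) = false); last by apply/eqP; lia.
  rewrite (_ : (i == j.+1 :> nat) = false); last by apply/eqP; lia.
  by rewrite !mulr0n !subr0 !mul0r !mulr0.
rewrite (_ : (j.+1 == i) = false); last by apply/eqP; lia.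
rewrite (_ : (i == j.+1 :> nat) = false); last by apply/eqP; lia.
rewrite !mulr0n !mulr1n sub0r subr0 E.
have iL : (i < L)%N by have := ltn_ord j; rewrite E.
have := Dcoef_step s0 iL; rewrite /mu /h E !natrB // ?(ltnW iL) // -natr1 => St.
transitivity (- 4 * (Dcoef s i * ((L%:R - i%:R) * (s + i%:R)))); first by ring.
by rewrite St; ring.
Qed.
End normalization.

(** * Symmetry of the normalized polynomials *)

Section assembly.
Variables (R : realType) (L : nat) (nu : R) (nu_gt0 : 0 < nu).
Local Notation K := R[i].
Local Notation M := 'M[{poly K}]_L.+1.
Local Notation H := (Hmx {poly K} L).
Local Notation W := (weight_mx L nu).
Local Notation tau := (L%:R + 2 * nu).
Variables (P : nat -> {poly 'M[K]_L.+1}) (P_gegenbauer : monic_gegenbauer nu P).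

Lemma pmx_mulC (c : 'M[K]_L.+1) p : pmx (c%:P * p) = map_mx polyC c * pmx p.
Proof.
apply/matrixP => i j; apply/polyP => k; rewrite coef_pmx coefCM !mxE coef_sum.
by apply: eq_bigr => l _; rewrite -coef_pmx [map_mx _ _ _ _]mxE coefCM.
Qed.

Let monP : monic_family (fun n => pmx (P n)).
Proof.
move=> n; have [/(_ n) [mon sz] _] := P_gegenbauer; split=> i j.
  by rewrite -sz size_pmx.
by rewrite coef_pmx; move/monicP : mon; rewrite lead_coefE sz /= => ->; rewrite mxE.
Qed.

Let monQ : monic_family (fun n => pmx_conj (P n)).
Proof.
move=> n; have [sz lead] := monP n; split=> i j.
  by rewrite mxE size_map_poly sz.
by rewrite mxE coef_map /= lead rmorph_nat.
Qed.

Let orth n m : n <> m -> weight_form (ultraC nu) W (pmx (P n)) (pmx_conj (P m)) = 0.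
Proof. by move=> nm; rewrite -mxinnerE; case: P_gegenbauer => _; exact. Qed.

Let tauE : tau%:C + 1 = (2 * nu + 1)%:C + L%:R.
Proof. by rewrite !rmorphD /= rmorph_nat rmorph1; ring. Qed.

Let LamD := ultraCD nu_gt0.
Let LamZ := ultraCZ nu_gt0.
Let LamI := ultraC_ibp nu_gt0.

Lemma pmx_opE n : opE (tau%:C)%:P n%:R%:P (pmx (P n)) = 0.
Proof.
apply: (@orth_opE _ _ tau%:C (weight_form (ultraC nu) W)) monP monQ orth n.
- exact: (@weight_formDr K L _ LamD _ (weight_mx_sym L nu)).
- exact: (@weight_formDl K L _ LamD W).
- exact: (@weight_form_mull K L _ LamD LamZ W).
- exact: (@weight_form_mulr K L _ LamD LamZ W (weight_mx_sym L nu)).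
- by move=> X Y; exact: (weight_form_Eop LamD LamZ LamI (weight_mx_sym L nu) (weight_Y_skew L nu)
    (weight_mx_H L nu_gt0) (weight_Y_ode L nu_gt0)).
- exact: weight_form_nondeg.
Qed.

Lemma pmx_opD n : opD (tau%:C)%:P n%:R%:P (pmx (P n)) = 0.
Proof.
apply: (@orth_opD _ _ tau%:C (weight_form (ultraC nu) W)) monP monQ orth n.
- exact: (@weight_formDr K L _ LamD _ (weight_mx_sym L nu)).
- exact: (@weight_formDl K L _ LamD W).
- exact: (@weight_form_mull K L _ LamD LamZ W).
- exact: (@weight_form_mulr K L _ LamD LamZ W (weight_mx_sym L nu)).
- by move=> X Y; exact: (weight_form_Dop tauE LamD LamZ LamI (weight_mx_sym L nu) (weight_Z_skew L nu)
    (weight_mx_C L nu_gt0) (weight_Z_ode L nu_gt0)).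
- exact: weight_form_nondeg.
Qed.

Lemma DmxE n i j : Dmx L nu n i j = (Dcoef L (nu + n%:R) i)%:C *+ (i == j).
Proof. by rewrite mxE. Qed.

Lemma tr_Dmx n : (Dmx L nu n)^T = Dmx L nu n.
Proof. by apply/matrixP => i j; rewrite mxE !DmxE eq_sym; case: eqP => // ->. Qed.

Lemma Dmx_unit n : Dmx L nu n \in unitmx.
Proof.
have -> : Dmx L nu n = diag_mx (\row_i (Dcoef L (nu + n%:R) i)%:C).
  by apply/matrixP => i j; rewrite DmxE !mxE.
rewrite unitmxE det_diag unitfE; apply/prodf_neq0 => i _.
by rewrite mxE fmorph_eq0 Dcoef_neq0 ?ltr_wpDr // -ltnS.
Qed.

Lemma mul_Dmx (n : nat) (X : M) i j :
  (map_mx polyC (Dmx L nu n) * X) i j = ((Dcoef L (nu + n%:R) i)%:C)%:P * X i j.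
Proof.
rewrite mxE (bigD1 i) //= big1 ?addr0 => [|l li].
  by rewrite mxE DmxE eqxx mulr1n.
by rewrite mxE DmxE eq_sym (negbTE li) mulr0n polyC0 mul0r.
Qed.

Lemma pmx_hatP_sym n : (pmx (hatP nu P n))^T = pmx (hatP nu P n).
Proof.
rewrite /hatP pmx_mulC; set c := map_mx polyC _; set X := pmx (P n).
have dc : dmx c = 0.
  by apply/matrixP => i j; rewrite !mxE derivC.
(* The only left multiplications in the two equations are by H and its square, so a constant
   diagonal [c] maps solutions to solutions. *)
have cH : c * H = H * c.
  apply/matrixP => i j; rewrite mulmx_H mul_Hmx mxE DmxE; case: eqP => [->|_]; first exact: mulrC.
  by rewrite mulr0n polyC0 mul0r mulr0.
have cHX Y : c * (H * Y) = H * (c * Y) by rewrite mulrA cH mulrA.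
have cZ a Y : c * (a *: Y) = a *: (c * Y) by rewrite scalerAr.
have dcX Y : dmx (c * Y) = c * dmx Y by rewrite dmxM dc mul0r add0r.
apply: (@mirror_symmetric R K (real_complex R) L n tau 1 (fun i => (Dcoef L (nu + n%:R) i)%:C)).
- by rewrite ltrDl mulr_gt0.
- move=> i j; have := @Dcoef_F R L (nu + n%:R) i j.
  rewrite mulrDr addrA => h; apply: h; exact: ltr_wpDr.
- have -> : opE (tau%:C)%:P n%:R%:P (c * X) = c * opE (tau%:C)%:P n%:R%:P X.
    by rewrite /opE dcX (mulrBr c) (mulrDr c) !cZ cHX !mulrA.
  by rewrite pmx_opE mulr0.
- have -> : opD (tau%:C)%:P n%:R%:P (c * X) = c * opD (tau%:C)%:P n%:R%:P X.
    by rewrite /opD !dcX (mulrDr c) 2!(mulrBr c) (mulrDr c) (mulrBr c) !cZ -!mulrA !cHX.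
  by rewrite pmx_opD mulr0.
- move=> i j; rewrite mul_Dmx mul_polyC; apply: (leq_trans (size_scale_leq _ _)).
  by case: (monP n).
- move=> i j; rewrite mul_Dmx coefCM; case: (monP n) => _ ->; rewrite mul1r.
  by case: (i == j); rewrite ?mulr1 ?mulr0.
Qed.
End assembly.

Theorem corollary3p7 (R : realType) (L : nat) (nu : R) (nu_gt0 : 0 < nu)
    (P : nat -> {poly 'M[R[i]]_L.+1}) (P_gegenbauer : monic_gegenbauer nu P) :
  (forall (n : nat) (x : R[i]),
     (mxeval (hatP nu P n) x)^T = mxeval (hatP nu P n) x) /\
  (forall (n : nat) (x : R[i]),
     (mxeval (P n) x)^T = Dmx L nu n *m mxeval (P n) x *m invmx (Dmx L nu n)).
Proof.
have hat_sym n x : (mxeval (hatP nu P n) x)^T = mxeval (hatP nu P n) x.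
  apply/matrixP => i j; rewrite mxE !mxeval_entry -[in RHS](pmx_hatP_sym nu_gt0 P_gegenbauer).
  by rewrite [in RHS]mxE.
split=> // n x; have := hat_sym n x.
have -> : mxeval (hatP nu P n) x = Dmx L nu n *m mxeval (P n) x.
  apply/matrixP => i j; rewrite mxeval_entry /hatP pmx_mulC mxE horner_sum mxE.
  by apply: eq_bigr => k _; rewrite hornerM [map_mx _ _ _ _]mxE hornerC -mxeval_entry.
rewrite trmx_mul tr_Dmx => <-.
by rewrite mulmxK // Dmx_unit.
Qed.
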